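(* Fix $\delta>0$ (with $\delta\neq 1$). Let $d_n=(\log n)^\gamma$, where $\gamma>0$. Let $\eta_n=(r_n-r_n^{-1})/2$, where $r_n=\exp(d_n^{-\alpha})$ for some $0<\alpha<\min(1,1/\gamma)$. Let $A_n$ be the adjacency matrix of the random regular graph $G(n,d_n)$, and for an interval $I\subset\mathbb{R}$ let $\mathcal{N}_I$ be the number of eigenvalues (with multiplicity) of $\frac{1}{\sqrt{d_n-1}}A_n$ in $I$. Then there exist $N$ and a sequence $p_n=o(1/n)$ such that for all $n\ge N$ and for any interval $I\subset\mathbb{R}$ of length $|I|\ge\max\{2\eta_n,\ \eta_n/(-\delta\log\delta)\}$, $$\Bigl|\mathcal{N}_I-n\int_I f_{\mathrm{sc}}(x)\,dx\Bigr|<\delta n|I|$$ with probability at least $1-p_n$.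
   Context: $G(n,d)$ denotes a graph chosen uniformly at random from the set of all labeled simple graphs with vertex set $\{1,\dots,n\}$ in which every vertex has degree $d$. Here $d_n=(\log n)^\gamma$ is understood as an integer (for instance an integer at distance at most $1$ from $(\log n)^\gamma$) with $d_n<n$ and $nd_n$ even, so that such graphs exist. The adjacency matrix is the symmetric $0/1$ matrix whose $(i,j)$ entry is $1$ iff $i$ and $j$ are joined by an edge. $f_{\mathrm{sc}}(x)=\frac{1}{2\pi}\sqrt{4-x^2}$ for $-2<x<2$ and $f_{\mathrm{sc}}(x)=0$ otherwise is the density of the semicircle law. *)

(* Defs.v *)
From HB Require Import structures.
From mathcomp Require Import all_boot all_order all_algebra.
From mathcomp Require Import all_classical all_reals all_analysis.
Set Implicit Arguments.
Unset Strict Implicit.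
Unset Printing Implicit Defensive.
Import Order.TTheory GRing.Theory Num.Theory.
Import numFieldNormedType.Exports.
Local Open Scope classical_set_scope.
Local Open Scope ring_scope.

(* A simple graph on 'I_n is given by its edge set G : {set {set 'I_n}}, all of
   whose members are pairs of distinct vertices. *)
Definition degree n (G : {set {set 'I_n}}) (v : 'I_n) : nat :=
  #|[set e : {set 'I_n} in G | v \in e]%SET|.

Definition regular_graphs n (d : nat) : {set {set {set 'I_n}}} :=
  [set G : {set {set 'I_n}} |
    [forall e : {set 'I_n} in G, #|e| == 2%N] && [forall v, degree G v == d]]%SET.

(* Meaningful when regular_graphs n d is nonempty, i.e. when d < n and n * d is
   even; the junk value is 0 otherwise. *)
Definition Prob_G (R : realType) n d (E : pred {set {set 'I_n}}) : R :=
  #|[set G in regular_graphs n d | E G]%SET|%:R / #|regular_graphs n d|%:R.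

(* The diagonal vanishes on simple graphs, since [set i; i] has one element. *)
Definition adjacency (R : realType) n (G : {set {set 'I_n}}) : 'M[R]_n :=
  \matrix_(i, j) ([set i; j]%SET \in G)%:R.

(* Number of eigenvalues of M in I, counted with algebraic multiplicity. Only
   real eigenvalues are seen, which are all of them when M is symmetric. The sum
   has finite support: it ranges over the roots of char_poly M. *)
Definition eig_count (R : realType) n (M : 'M[R]_n) (I : interval R) : nat :=
  \big[addn/0%N]_(x \in [set` I]) mup x (char_poly M).

Definition f_sc (R : realType) (x : R) : R :=
  if -2 < x < 2 then (2 * pi)^-1 * Num.sqrt (4 - x ^+ 2) else 0.

Definition r_ (R : realType) (alpha : R) (d : nat) : R :=
  expR (d%:R `^ (- alpha)).

Definition eta_ (R : realType) (alpha : R) (d : nat) : R :=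
  (r_ alpha d - (r_ alpha d)^-1) / 2.

Definition N_ (R : realType) n (d : nat) (G : {set {set 'I_n}})
    (I : interval R) : nat :=
  eig_count ((Num.sqrt (d%:R - 1))^-1 *: adjacency R G) I.

(* Main.v *)
(* The spectral counting function is compared with the semicircle law in
   Kolmogorov distance. By the Chebyshev-Markov-Stieltjes inequality, a
   probability measure whose integrals against U_1(x/2), ..., U_(2m-2)(x/2)
   are small is within O(1/m) of the semicircle law. For a d-regular graph, the
   trace of U_k(x/2) at x = A/sqrt(d-1), times (d-1)^(k/2), is the number of
   closed nonbacktracking walks of length at most k and of the parity of k;
   the trivial walks contribute O(1/d) to the distance. The image of one or two
   closed nonbacktracking walks has at least as many edges as vertices, while a
   switching argument bounds the probability that a given set F of edges is
   present by (2d/n)^|F|; hence the number of closed nonbacktracking walks of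
   length at most 2m has second moment n^(o(1)), and exceeds n^(3/4) with
   probability o(1/n) when m = (log n)^beta with beta < 1. Taking
   gamma alpha < beta, the distance 1/m + 1/d is o(d^(-alpha)), while
   |I| >= 2 eta >= d^(-alpha). *)
Require Import Defs.
From mathcomp Require Import all_boot all_order all_algebra.
From mathcomp Require Import zify ring lra.
Set Implicit Arguments.
Unset Strict Implicit.
Unset Printing Implicit Defensive.
Import Order.TTheory GRing.Theory Num.Theory.

(** * Edge switchings in regular graphs *)

Section Switching.
Variables (n d : nat).
Implicit Types (G F : {set {set 'I_n}}) (e : {set 'I_n}) (u v x y t : 'I_n).

(** Randomness enters through a single statistic, the number of short closed nonbacktracking walks:
    once it is at most n^(3/4), the estimate holds deterministically for all intervals at once, so
    p_n does not depend on I. Markov's inequality for the first moment, with a threshold below n,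
    would not give o(1/n); for the square it gives n^(1/4 - 3/2) = n^(-5/4), where n^(1/4) absorbs
    every n^(o(1)). Comparing edges with vertices matters because v vertices can be placed in at
    most n^v ways, and (2d/n)^e cancels this power of n once e >= v. On the analytic side the
    semicircle law is replaced by its m-point Gauss quadrature, with explicit nodes and weights, so
    that orthogonality of the U_k becomes a finite cosine sum. The majorant q of a half-line is
    never expanded: since q and the weights are nonnegative, its coefficients satisfy |c_k| <= (k +
    1) c_0, and c_0 <= 1. The density itself is met only at the end, through the substitution x = 2
    cos t. *)

Definition neighbors G u : {set 'I_n} := [set x | [set u; x] \in G].

Definition copies F : nat := #|[set G in regular_graphs n d | F \subset G]|.

Lemma regular_graphsP G :
  reflect ((forall e, e \in G -> #|e| = 2) /\ forall v, degree G v = d)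
          (G \in regular_graphs n d).
Proof.
rewrite inE; apply: (iffP andP) => [[/forall_inP h1 /forallP h2]|[h1 h2]].
  by split=> [e /h1/eqP|v]; [|apply/eqP/h2].
by split; [apply/forall_inP => e /h1/eqP | apply/forallP => v; apply/eqP].
Qed.

Lemma degree_sum G t : degree G t = \sum_(e in G) (t \in e).
Proof.
rewrite /degree -sum1_card big_mkcond [RHS]big_mkcond /=.
by apply: eq_bigr => e _; rewrite inE; case: (e \in G) => //=; case: (t \in e).
Qed.

Lemma set2_injr u : injective (fun x => [set u; x]).
Proof.
move=> x y /setP E; move: (E x) (E y); rewrite !inE !eqxx !orbT.
case: (eqVneq x u) => [->|_] /=; last by move/esym/eqP.
by move=> _ /orP[]/eqP->.
Qed.

Lemma edge_neq G u x : G \in regular_graphs n d -> [set u; x] \in G -> u != x.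
Proof. by case/regular_graphsP => h _ /h; rewrite cards2; case: eqP. Qed.

Lemma card_neighbors G u : G \in regular_graphs n d -> #|neighbors G u| = d.
Proof.
move=> rG; have [h1 h2] := regular_graphsP _ rG.
rewrite -(h2 u) /degree -(card_imset _ (@set2_injr u)); congr #|pred_of_set _|.
apply/setP => e; rewrite inE; apply/imsetP/andP.
  by case=> x; rewrite inE => ux ->; rewrite set21.
case=> eG ue; have /eqP := h1 _ eG; case/cards2P => a [b [_ Ee]]; subst e.
move: ue; rewrite !inE => /orP[]/eqP->; first by exists b; rewrite ?inE.
by rewrite setUC in eG *; exists a; rewrite ?inE.
Qed.

Lemma card_pairs (P : 'I_n -> 'I_n -> bool) :
  #|[set p : 'I_n * 'I_n | P p.1 p.2]| = \sum_x #|[set y | P x y]|.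
Proof.
rewrite -sum1_card; under [RHS]eq_bigr do rewrite -sum1_card.
rewrite pair_big_dep /=; apply: eq_bigl => p; rewrite !inE //.
Qed.

Lemma card_pairs_adj G : G \in regular_graphs n d ->
  #|[set p : 'I_n * 'I_n | [set p.1; p.2] \in G]| = n * d.
Proof.
move=> rG; rewrite (card_pairs (fun x y => [set x; y] \in G)).
under eq_bigr do rewrite (card_neighbors _ rG).
by rewrite sum_nat_const card_ord.
Qed.

Lemma card_pairs_in F : #|[set p : 'I_n * 'I_n | [set p.1; p.2] \in F]| <= 2 * #|F|.
Proof.
have h e : #|[set p : 'I_n * 'I_n | [set p.1; p.2] == e]| <= 2.
  case: (set_0Vmem [set p : 'I_n * 'I_n | [set p.1; p.2] == e]) => [->|[[a b]]].
    by rewrite cards0.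
  rewrite inE /= => /eqP <-.
  apply: leq_trans (_ : #|[set (a, b); (b, a)]| <= 2); last by rewrite cards2; case: eqP.
  apply/subset_leq_card/subsetP => -[x y]; rewrite !inE /= => /eqP /setP E.
  move: (E x) (E y) (E a) (E b); rewrite !inE !eqxx /= !orbT !xpair_eqE.
  case/esym/orP => /eqP-> /esym/orP[]/eqP->; rewrite ?eqxx ?orbT ?orbb //= => *.
    by rewrite eq_sym; apply/orP; left.
  by rewrite eq_sym; apply/orP; right.
apply: leq_trans (_ : \sum_(e in F) #|[set p : 'I_n * 'I_n | [set p.1; p.2] == e]| <= _).
  rewrite -sum1_card (eq_bigl (fun p : 'I_n * 'I_n => [set p.1; p.2] \in F)); last first.
    by move=> p; rewrite inE.
  rewrite (partition_big (fun p : 'I_n * 'I_n => [set p.1; p.2]) (fun e => e \in F)) //=.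
  apply: leq_sum => e eF; rewrite -sum1_card; apply: eq_leq; apply: eq_bigl => p.
  by rewrite inE; case: eqP => [->|]; rewrite ?andbF // eF.
by rewrite mulnC -sum_nat_const; apply: leq_sum => e _.
Qed.

Lemma card_pairs_swap (P : 'I_n -> 'I_n -> bool) :
  #|[set p : 'I_n * 'I_n | P p.2 p.1]| = #|[set p : 'I_n * 'I_n | P p.1 p.2]|.
Proof.
have swapK : involutive (fun p : 'I_n * 'I_n => (p.2, p.1)) by case.
rewrite -[LHS](card_imset _ (inv_inj swapK)); congr #|pred_of_set _|.
apply/setP => -[x y]; rewrite inE /=; apply/imsetP/idP => [[[a b]]|Pxy].
  by rewrite inE /= => Pba [-> ->].
by exists (y, x); rewrite ?inE.
Qed.

Lemma card_pairs_adj1 G (P : pred 'I_n) : G \in regular_graphs n d ->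
  #|[set p : 'I_n * 'I_n | ([set p.1; p.2] \in G) && P p.1]| = #|P| * d.
Proof.
move=> rG; rewrite (card_pairs (fun x y => ([set x; y] \in G) && P x)).
rewrite -sum_nat_const [RHS]big_mkcond /=; apply: eq_bigr => x _.
rewrite unfold_in; case: (P x); last by apply: eq_card0 => y; rewrite !inE andbF.
by rewrite -(card_neighbors x rG); apply: eq_card => y; rewrite !inE andbT.
Qed.

Lemma card_pairs_adj2 G (P : pred 'I_n) : G \in regular_graphs n d ->
  #|[set p : 'I_n * 'I_n | ([set p.1; p.2] \in G) && P p.2]| = #|P| * d.
Proof.
move=> rG; rewrite -(card_pairs_adj1 P rG).
rewrite -(card_pairs_swap (fun x y => ([set x; y] \in G) && P x)).
by apply: eq_card => p; rewrite !inE setUC.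
Qed.

Lemma mem_set2 t a b : a != b -> (t \in [set a; b] : nat) = (t == a) + (t == b).
Proof. by move=> ab; rewrite !inE; case: (eqVneq t a) ab => [->|_] //=; case: (a == b). Qed.

(** Replace the edges uv and xy by ux and vy. At least n d - (2|F| + 2d^2 + 2d) oriented edges (x,
    y) are admissible: excluded are those in [F], those with x = u or y = v, and those with x
    adjacent to u or y adjacent to v. Backwards, x is a neighbor of u and y one of v, which leaves
    d^2 choices. Double counting concludes. *)
Lemma copies_switch u v F : [set u; v] \notin F -> u != v ->
  (n * d - (2 * #|F| + 2 * d ^ 2 + 2 * d)) * copies ([set u; v] |: F) <= d ^ 2 * copies F.
Proof.
move=> uvF uv.
pose sw G (p : 'I_n * 'I_n) : {set {set 'I_n}} :=
  [set u; p.1] |: ([set v; p.2] |: (G :\ [set u; v] :\ [set p.1; p.2])).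
pose V G := [set p : 'I_n * 'I_n | [&& [set p.1; p.2] \in G, [set p.1; p.2] \notin F,
  p.1 != u, p.2 != v, p.1 \notin neighbors G u & p.2 \notin neighbors G v]].
pose A := [set G in regular_graphs n d | [set u; v] |: F \subset G].
pose B := [set G in regular_graphs n d | F \subset G].
have AP G : G \in A -> [/\ G \in regular_graphs n d, [set u; v] \in G & F \subset G].
  by rewrite inE subUset sub1set => /and3P[].
have distinct G x y : G \in A -> (x, y) \in V G ->
    [/\ x != u, x != v, y != u, y != v & x != y].
  move=> /AP[rG uvG FG]; rewrite inE /= => /and5P[xyG _ xu yv /andP[xNu yNv]].
  split=> //; last exact: edge_neq rG xyG.
    by apply: contraNneq xNu => ->; rewrite inE.
  by apply: contraNneq yNv => ->; rewrite inE setUC.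
have VA G : G \in A -> n * d - (2 * #|F| + 2 * d ^ 2 + 2 * d) <= #|V G|.
  move=> /AP[rG uvG FG]; rewrite leq_subLR -(card_pairs_adj rG).
  pose adj := [set p : 'I_n * 'I_n | [set p.1; p.2] \in G].
  pose W1 := [set p : 'I_n * 'I_n | [set p.1; p.2] \in F].
  pose W2 := [set p : 'I_n * 'I_n | ([set p.1; p.2] \in G) && pred1 u p.1].
  pose W3 := [set p : 'I_n * 'I_n | ([set p.1; p.2] \in G) && pred1 v p.2].
  pose W4 := [set p : 'I_n * 'I_n | ([set p.1; p.2] \in G) && mem (neighbors G u) p.1].
  pose W5 := [set p : 'I_n * 'I_n | ([set p.1; p.2] \in G) && mem (neighbors G v) p.2].
  have c1 : #|W1| <= 2 * #|F| := card_pairs_in F.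
  have c2 : #|W2| = d by rewrite card_pairs_adj1 // card1 mul1n.
  have c3 : #|W3| = d by rewrite card_pairs_adj2 // card1 mul1n.
  have c4 : #|W4| = d ^ 2.
    by rewrite card_pairs_adj1 // -mulnn -{2}(card_neighbors u rG).
  have c5 : #|W5| = d ^ 2.
    by rewrite card_pairs_adj2 // -mulnn -{2}(card_neighbors v rG).
  have sub : adj \subset V G :|: W1 :|: W2 :|: W3 :|: W4 :|: W5.
    apply/subsetP => p; rewrite !inE => pG; rewrite pG /=.
    by do ![case: (_ \in _) => //=; rewrite ?orbT //=]; do ![case: (_ == _) => //=].
  have := subset_leq_card sub; rewrite -/adj => /leq_trans; apply.
  move: (leq_card_setU (V G) W1).1 (leq_card_setU (V G :|: W1) W2).1.
  move: (leq_card_setU (V G :|: W1 :|: W2) W3).1.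
  move: (leq_card_setU (V G :|: W1 :|: W2 :|: W3) W4).1.
  move: (leq_card_setU (V G :|: W1 :|: W2 :|: W3 :|: W4) W5).1.
  by rewrite c2 c3 c4 c5; lia.
have swB G p : G \in A -> p \in V G -> sw G p \in B.
  case: p => x y GA pV; have [xu xv yu yv xy] := distinct _ _ _ GA pV.
  have [rG uvG FG] := AP _ GA; have [h1 h2] := regular_graphsP _ rG.
  move: pV; rewrite in_set /= => /and5P[xyG xyF _ _ /andP[uxG vyG]].
  rewrite inE in uxG; rewrite inE in vyG.
  rewrite in_set; apply/andP; split; last first.
    apply/subsetP => e eF; rewrite /sw !inE (subsetP FG _ eF) andbT /=.
    by rewrite (contraTneq _ eF) ?(contraTneq _ eF) ?orbT // => ->.
  apply/regular_graphsP; split.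
    move=> e; rewrite /sw !inE /= => /or3P[/eqP->|/eqP->|/and3P[_ _ /h1]] //.
      by rewrite cards2 eq_sym xu.
    by rewrite cards2 eq_sym yv.
  (* Degrees are sums of indicators over edges; each of u, v, x, y lies on one removed and one added
     edge. *)
  move=> t; rewrite -(h2 t) !degree_sum /sw /= [in RHS](big_setD1 [set u; v]) //=.
  rewrite [in RHS](big_setD1 [set x; y]) /=; last first.
    rewrite !inE xyG andbT; apply/eqP => /setP/(_ u); rewrite !inE eqxx /=.
    by rewrite eq_sym (negPf xu) eq_sym (negPf yu).
  rewrite big_setU1 /=; last first.
    rewrite !inE (negPf uxG) !andbF orbF; apply/eqP => /setP/(_ u).
    by rewrite !inE eqxx /= (negPf uv) eq_sym (negPf yu).
  rewrite big_setU1 /=; last by rewrite !inE (negPf vyG) !andbF.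
  rewrite eq_sym in xu; rewrite eq_sym in yv.
  by rewrite (mem_set2 _ xu) (mem_set2 _ yv) (mem_set2 _ uv) (mem_set2 _ xy); ring.
have swK G p : G \in A -> p \in V G ->
    [set u; v] |: ([set p.1; p.2] |: (sw G p :\ [set u; p.1] :\ [set v; p.2])) = G.
  case: p => x y GA; rewrite in_set /= => /and5P[xyG _ _ _ /andP[uxG vyG]].
  rewrite inE in uxG; rewrite inE in vyG.
  have [_ uvG _] := AP _ GA.
  apply/setP => e; rewrite /sw !inE /=.
  case: (eqVneq e [set u; v]) => [->|_] /=; first by rewrite uvG.
  case: (eqVneq e [set x; y]) => [->|_] /=; first by rewrite xyG.
  case: (eqVneq e [set v; y]) => [->|_] /=; first by rewrite (negPf vyG).
  by case: (eqVneq e [set u; x]) => [->|_] /=; first by rewrite (negPf uxG).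
pose D := [set q : {set {set 'I_n}} * ('I_n * 'I_n) | (q.1 \in A) && (q.2 \in V q.1)].
pose D' := [set q : {set {set 'I_n}} * ('I_n * 'I_n) |
  [&& q.1 \in B, q.2.1 \in neighbors q.1 u & q.2.2 \in neighbors q.1 v]].
have cD : #|D| = \sum_(G in A) #|V G|.
  rewrite -sum1_card; under [RHS]eq_bigr do rewrite -sum1_card.
  by rewrite pair_big_dep /=; apply: eq_bigl => q; rewrite !inE.
have cD' : #|D'| = d ^ 2 * copies F.
  rewrite -sum1_card.
  transitivity (\sum_(G in B) \sum_(p in setX (neighbors G u) (neighbors G v)) 1).
    by rewrite pair_big_dep /=; apply: eq_bigl => q; rewrite !inE.
  rewrite (eq_bigr (fun=> d ^ 2)); first by rewrite sum_nat_const mulnC.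
  move=> G; rewrite inE => /andP[rG _].
  by rewrite sum1_card cardsX !card_neighbors // mulnn.
rewrite -cD'; apply: (@leq_trans #|D|).
  by rewrite cD mulnC -sum_nat_const; apply: leq_sum => G GA; apply: VA.
(* The map (G, p) -> (sw G p, p) is injective because [swK] undoes the switching. *)
rewrite -(@card_in_imset _ _ (fun q => (sw q.1 q.2, q.2)) D).
  apply/subset_leq_card/subsetP => _ /imsetP[[G [x y]] + ->].
  rewrite in_set /= => /andP[GA pV].
  by rewrite in_set /= (swB _ _ GA pV) !inE !eqxx orbT.
move=> [G p] [G' p']; rewrite !(in_set (fun q => (q.1 \in A) && _)) /=.
move=> /andP[GA pV] /andP[GA' pV'] [E Ep].
by rewrite -(swK G p) // -(swK G' p') // E Ep.
Qed.
End Switching.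

Section Copies.
Variables (n d : nat).

(** Edges of [F] are dropped one at a time by switching. The size hypothesis keeps the excluded
    pairs below half of n d, so each edge costs a factor 2d/n. An [F] with a member that is not a
    pair has no copies. *)
Lemma copies_le m (F : {set {set 'I_n}}) : 0 < d ->
  2 * (2 * m + 2 * d ^ 2 + 2 * d) <= n * d -> #|F| <= m.+1 ->
  copies d F * n ^ #|F| <= (2 * d) ^ #|F| * #|regular_graphs n d|.
Proof.
move=> d_gt0 hm; elim: {F}#|F| {-2}F (erefl #|F|) => [|k IH] F Fk km.
  rewrite Fk !expn0 muln1 mul1n; apply/subset_leq_card/subsetP => G.
  by rewrite inE => /andP[].
have /card_gt0P[e eF] : 0 < #|F| by rewrite Fk.
case: (eqVneq #|e| 2) => [/eqP|e2]; last first.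
  rewrite /copies eq_card0 // => G; rewrite in_set; apply/negP => /andP[rG FG].
  have [h1 _] := regular_graphsP _ _ rG.
  by move: e2; rewrite h1 ?eqxx // (subsetP FG).
case/cards2P => u [v [uv Ee]].
have Fk' : #|F :\ e| = k by move: (cardsD1 e F); rewrite eF Fk => -[].
rewrite Fk in km *; have := IH _ Fk'; rewrite Fk' => /(_ (ltnW km)).
have : [set u; v] \notin F :\ e by rewrite -Ee !inE eqxx.
move/(copies_switch d)/(_ uv); rewrite -Ee setD1K // Fk'.
set c := copies d F; set c' := copies d _; set o := #|_|; set b := 2 * k + _ + _.
move=> h1 h2.
have h3 : n * c <= 2 * d * c'.
  have hb : n * d <= 2 * (n * d - b) by rewrite mulnBr; move: hm; rewrite /b; lia.
  rewrite -(leq_pmul2l d_gt0); apply: leq_trans (_ : 2 * (d ^ 2 * c') <= _); last first.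
    by rewrite -mulnn !mulnA (mulnC 2).
  apply: leq_trans (_ : 2 * ((n * d - b) * c) <= _); last by rewrite leq_mul2l h1 orbT.
  by rewrite !mulnA (mulnC d) leq_mul2r hb orbT.
rewrite !expnS mulnA [c * n]mulnC; apply: leq_trans (_ : 2 * d * c' * n ^ k <= _).
  by rewrite leq_mul2r h3 orbT.
by rewrite -!mulnA; do 2!rewrite leq_mul2l; rewrite h2 !orbT.
Qed.
End Copies.

(** * Existence of regular graphs: circulants *)

Section Existence.

Lemma regular_graphs_of_rel n d (r : rel 'I_n) :
  symmetric r -> irreflexive r -> (forall x, #|[set y | r x y]| = d) ->
  exists G, G \in regular_graphs n d.
Proof.
move=> rsym rirr rd.
pose G := [set e : {set 'I_n} | [exists x, exists y, r x y && (e == [set x; y])]].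
have GP e : reflect (exists x y, r x y /\ e = [set x; y]) (e \in G).
  rewrite inE; apply: (iffP existsP) => [[x /existsP[y /andP[rxy /eqP->]]]|].
    by exists x, y.
  by case=> x [y [rxy ->]]; exists x; apply/existsP; exists y; rewrite rxy eqxx.
have Gr x y : ([set x; y] \in G) = r x y.
  apply/GP/idP => [[a [b [rab /setP E]]]|rxy]; last by exists x, y.
  have ab : a != b by apply: contraTneq rab => ->; rewrite rirr.
  move: (E x) (E y) (E a) (E b); rewrite !inE !eqxx /= !orbT.
  case/esym/orP => /eqP-> /esym/orP[]/eqP->; rewrite ?orbb ?(negPf ab) //.
    by rewrite eq_sym (negPf ab).
  by rewrite rsym.
exists G; apply/regular_graphsP; split.
  move=> _ /GP[x [y [rxy ->]]]; rewrite cards2.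
  by case: eqVneq rxy => // ->; rewrite rirr.
move=> v; rewrite -(rd v) /degree -(card_imset _ (@set2_injr _ v)).
congr #|pred_of_set _|; apply/setP => e; rewrite inE; apply/andP/imsetP.
  case=> /GP[x [y [rxy ->]]]; rewrite !inE => /orP[]/eqP->.
    by exists y; rewrite ?inE.
  by rewrite setUC; exists x; rewrite ?inE 1?rsym.
by case=> x; rewrite inE => rvx ->; rewrite Gr rvx set21.
Qed.

Lemma card_Zp_translate n (S : {set 'I_n.+1}) x :
  #|[set y : 'I_n.+1 | (y - x)%R \in S]| = #|S|.
Proof.
rewrite -[RHS](card_imset _ (addIr x)); congr #|pred_of_set _|.
apply/setP => y; apply/idP/imsetP => [|[z zS ->]]; rewrite inE ?addrK //.
by move=> yS; exists (y - x)%R; rewrite ?subrK.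
Qed.

(** In Z/(n+1), 2x = 0 forces x = 0 or, as integers, 2x = n + 1. *)
Lemma card_Zp_self_inverse n : #|[set x : 'I_n.+1 | (x == - x)%R]| <= 2.
Proof.
apply: leq_trans (_ : #|[set 0%R; inord n.+1./2 : 'I_n.+1]| <= 2); last first.
  by rewrite cards2; case: (_ != _).
apply/subset_leq_card/subsetP => x; rewrite !inE -addr_eq0.
move/eqP/(congr1 val) => /=; have := ltn_ord x.
case: (eqVneq x 0%R) => //= x0 xn.
have {x0} x0 : 0 < x by rewrite lt0n; apply: contra x0 => /eqP E; apply/eqP/val_inj.
case: (ltnP (x + x) n.+1) => [h|h]; first by rewrite modn_small //; lia.
have -> : x + x = x + x - n.+1 + n.+1 by lia.
rewrite modnDr modn_small; last by lia.
by move=> E; apply/eqP/val_inj; rewrite /= inordK; lia.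
Qed.

(** At most two elements equal their opposites, so a complement of size at least three contains some
    x distinct from -x, and the pair {x, -x} can be added. *)
Lemma symmetric_set_extend n (S : {set 'I_n.+1}) : #|S| + 3 <= n.+1 ->
  0%R \notin S -> (forall x, x \in S -> (- x)%R \in S) ->
  exists S' : {set 'I_n.+1},
    [/\ #|S'| = #|S| + 2, 0%R \notin S' & forall x, x \in S' -> (- x)%R \in S'].
Proof.
move=> cS S0 SN.
have /subsetPn[x] : ~~ (~: S \subset [set x : 'I_n.+1 | (x == - x)%R]).
  apply/negP => /subset_leq_card; rewrite leqNgt.
  rewrite (leq_ltn_trans (card_Zp_self_inverse n)) //.
  by have := cardsC S; rewrite card_ord; lia.
rewrite !inE => xS xN.
have NS : (- x)%R \notin S by apply: contra xS => /SN; rewrite opprK.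
exists (x |: ((- x)%R |: S)); split.
- by rewrite !cardsU1 !inE (negPf xN) (negPf xS) NS; lia.
- rewrite !inE (negPf S0) orbF negb_or -[in X in _ && X]oppr0 eqr_opp !andbb.
  by apply: contraNneq xN => <-; rewrite oppr0.
move=> y; rewrite !inE => /or3P[/eqP->|/eqP->|/SN->]; rewrite ?opprK ?eqxx ?orbT //.
Qed.

(** Pairs {x, -x} raise the size by two, starting from the empty set or, for odd d, from the element
    (n+1)/2 of order two, available because n + 1 is then even. *)
Lemma symmetric_set_exists n d : d < n.+1 -> ~~ odd (n.+1 * d) ->
  exists S : {set 'I_n.+1},
    [/\ #|S| = d, 0%R \notin S & forall x, x \in S -> (- x)%R \in S].
Proof.
elim/ltn_ind: d => -[|[|d]] IH dn dodd.
- by exists set0; rewrite cards0 in_set0; split=> // x; rewrite in_set0.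
- move: dodd; rewrite muln1 => nodd; exists [set inord n.+1./2].
  have h : n.+1./2 < n.+1 by lia.
  rewrite cards1; split=> //.
    by rewrite inE -val_eqE /= inordK //; lia.
  move=> x; rewrite !inE => /eqP->; apply/eqP/val_inj; rewrite /= !inordK //.
  by rewrite modn_small; lia.
have [|||S [cS S0 SN]] := IH d; [lia|lia|by move: dodd; rewrite !oddM /= negbK|].
have [|S' [cS' S0' SN']] := symmetric_set_extend _ S0 SN; first by lia.
by exists S'; split=> //; rewrite cS' cS addn2.
Qed.

(** The witness is the circulant graph joining x and y when y - x lies in a symmetric set of size
    d. *)
Lemma regular_graphs_neq0 n d : d < n -> ~~ odd (n * d) -> 0 < #|regular_graphs n d|.
Proof.
case: n => // n dn dodd; have [S [cS S0 SN]] := symmetric_set_exists dn dodd.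
have [|||G rG] := @regular_graphs_of_rel _ d (fun x y : 'I_n.+1 => (y - x)%R \in S).
- by move=> x y; apply/idP/idP => /SN; rewrite opprB.
- by move=> x; rewrite subrr (negPf S0).
- by move=> x; rewrite card_Zp_translate.
by apply/card_gt0P; exists G.
Qed.
End Existence.

(** * Closed nonbacktracking walks *)

Section Walks.
Variable n : nat.
Implicit Types (p x y z : 'I_n) (s : seq 'I_n) (G E : {set {set 'I_n}}) (V : {set 'I_n}).

(** [p] is the vertex visited just before [x]. Taking p = x encodes a walk without a past, since z
    != x is required anyway. *)
Fixpoint reduced p x s : bool :=
  if s is z :: s' then [&& z != x, z != p & reduced x z s'] else true.

Fixpoint walk_edges x s : {set {set 'I_n}} :=
  if s is z :: s' then [set x; z] |: walk_edges z s' else set0.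

(** A step to a new vertex uses an edge not contained in [V], hence a new one: vertices never grow
    faster than edges. *)
Lemma excess_mono s V E x c : (forall e, e \in E -> e \subset V) -> x \in V ->
  #|V| <= #|E| + c -> #|V :|: [set y in s]| <= #|E :|: walk_edges x s| + c.
Proof.
elim: s V E x => [|z s IH] V E x EV xV le_VE /=.
  by rewrite set_nil !setU0.
rewrite set_cons !setUA (setUC V) (setUC E).
apply: IH; last 2 first.
- by rewrite !inE eqxx.
- rewrite !cardsU1; case: (boolP (z \in V)) => zV /=.
    by move: #|V| #|E| le_VE => a b; case: (_ \notin E) => /=; lia.
  suff -> : [set x; z] \notin E by move: #|V| #|E| le_VE => a b /=; lia.
  by apply: contra zV => /EV/subsetP; apply; rewrite set22.
move=> e; rewrite !inE => /orP[/eqP->|/EV eV].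
  by rewrite subUset !sub1set !inE xV eqxx orbT.
by rewrite (subset_trans eV) // subsetUr.
Qed.

(* As long as the walk only discovers new vertices, its last vertex x is a leaf
   whose unique edge comes from p. A reduced walk cannot step back along that
   edge, so its first step to an old vertex uses a new edge. *)
Lemma excess_path s V E p x w : (forall e, e \in E -> e \subset V) ->
  x \in V -> w \in V -> x != w -> (forall e, e \in E -> x \in e -> e = [set p; x]) ->
  #|V| <= #|E|.+1 -> reduced p x s -> last x s = w ->
  #|V :|: [set y in s]| <= #|E :|: walk_edges x s|.
Proof.
elim: s V E p x => [|z s IH] V E p x EV xV wV xw Ex le_VE /=.
  by move=> _ E0; rewrite E0 eqxx in xw.
case/and3P => zx zp reds lasts; rewrite set_cons !setUA (setUC V) (setUC E).
have EV' e : e \in [set x; z] |: E -> e \subset z |: V.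
  rewrite !inE => /orP[/eqP->|/EV eV].
    by rewrite subUset !sub1set !inE xV eqxx orbT.
  by rewrite (subset_trans eV) // subsetUr.
case: (boolP (z \in V)) => zV.
  rewrite -[leqRHS]addn0; apply: excess_mono => //; first by rewrite !inE eqxx.
  rewrite !cardsU1 zV /=; suff -> : [set x; z] \notin E by move: #|V| #|E| le_VE => a b /=; lia.
  apply/negP => /Ex; rewrite set21 => /(_ isT)/setP/(_ z).
  by rewrite !inE eqxx orbT (negPf zx) (negPf zp).
have xzE e : e \in E -> z \notin e by move/EV/subsetP => eV; apply: contra zV => /eV.
apply: (IH _ _ x) => //.
- by rewrite !inE eqxx.
- by rewrite !inE wV orbT.
- by apply: contraNneq zV => ->.
- move=> e; rewrite !inE => /orP[/eqP-> //|/xzE ze]; by rewrite (negPf ze).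
rewrite !cardsU1 zV; suff -> : [set x; z] \notin E by move: #|V| #|E| le_VE => a b /=; lia.
by apply/negP => /xzE; rewrite set22.
Qed.

(** A walk starting in [V] is covered by monotonicity. A start outside [V] puts the edges one
    behind; the missing edge is recovered at the first return to an old vertex, which must occur
    because the walk is closed. *)
Lemma excess_closed s V E x : (forall e, e \in E -> e \subset V) ->
  #|V| <= #|E| -> s != [::] -> reduced x x s -> last x s = x ->
  #|V :|: [set y in x :: s]| <= #|E :|: walk_edges x s|.
Proof.
move=> EV le_VE s0 reds lasts; rewrite set_cons setUA (setUC V).
case: (boolP (x \in V)) => xV.
  rewrite (setUidPr (_ : [set x] \subset V)) ?sub1set // -[leqRHS]addn0.
  by apply: excess_mono; rewrite ?addn0.
case: s s0 reds lasts => // z s _ /= /and3P[zx _ reds] lasts.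
have xE e : e \in E -> x \notin e by move/EV/subsetP => eV; apply: contra xV => /eV.
rewrite set_cons setUA (setUC (x |: V)) !(setUA E) (setUC E).
have EV' e : e \in [set x; z] |: E -> e \subset z |: (x |: V).
  rewrite !inE => /orP[/eqP->|/EV eV].
    by rewrite subUset !sub1set !inE !eqxx !orbT.
  by rewrite (subset_trans eV) // setUA subsetUr.
have nE : [set x; z] \notin E by apply/negP => /xE; rewrite set21.
case: (boolP (z \in V)) => zV.
  rewrite -[leqRHS]addn0; apply: excess_mono => //; first by rewrite !inE eqxx.
  by rewrite !cardsU1 !inE zV orbT xV nE; move: #|V| #|E| le_VE => a b /=; lia.
(* Two new vertices but one new edge so far: z is a leaf attached to x, and the walk still has to
   come back to w = x. *)
apply: (excess_path (p := x) (w := x)) => //.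
- by rewrite !inE eqxx.
- by rewrite !inE eqxx orbT.
- move=> e; rewrite !inE => /orP[/eqP-> //|eE].
  by move/(subsetP (EV _ eE)); rewrite (negPf zV).
- by rewrite !cardsU1 !inE (negPf zx) (negPf zV) xV nE; move: #|V| #|E| le_VE => a b /=; lia.
Qed.

Lemma walk_edges_sub x s e : e \in walk_edges x s -> e \subset [set y in x :: s].
Proof.
elim: s x => [|z s IH] x /=; first by rewrite inE.
rewrite !inE => /orP[/eqP->|/IH ez].
  by rewrite subUset !sub1set !inE !eqxx orbT.
by rewrite (subset_trans ez) // (set_cons x) subsetUr.
Qed.

Lemma excess_closed2 x1 s1 x2 s2 : s1 != [::] -> s2 != [::] ->
  reduced x1 x1 s1 -> reduced x2 x2 s2 -> last x1 s1 = x1 -> last x2 s2 = x2 ->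
  #|[set y in x1 :: s1] :|: [set y in x2 :: s2]|
    <= #|walk_edges x1 s1 :|: walk_edges x2 s2|.
Proof.
move=> s10 s20 r1 r2 l1 l2; apply: excess_closed => //.
  by move=> e; apply: walk_edges_sub.
rewrite -(set0U [set y in _]) -(set0U (walk_edges _ _)); apply: excess_closed => //.
  by move=> e; rewrite inE.
by rewrite !cards0.
Qed.

Lemma sum_tuple_cons k (F : k.+1.-tuple 'I_n -> nat) :
  \sum_t F t = \sum_z \sum_(s : k.-tuple 'I_n) F [tuple of z :: s].
Proof.
rewrite pair_bigA /= (reindex (fun q : 'I_n * k.-tuple 'I_n => [tuple of q.1 :: q.2])) //=.
exists (fun t => (thead t, [tuple of behead t])) => [[z s] _|t _].
  by congr pair; apply/val_inj.
by rewrite -tuple_eta.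
Qed.

Lemma card_tuples_in k V : #|[set s : k.-tuple 'I_n | all (mem V) s]| = #|V| ^ k.
Proof.
rewrite -sum1_card big_mkcond /=.
under eq_bigr do rewrite inE.
elim: k => [|k IH].
  rewrite expn0 -[RHS](card_tuple 0 'I_n) -sum1_card.
  by apply: eq_bigr => t _; rewrite tuple0.
rewrite sum_tuple_cons /= expnS -IH -sum_nat_const [RHS]big_mkcond /=.
by apply: eq_bigr => z _; case: (z \in V) => //; rewrite sum_nat_const muln0.
Qed.

(** The last edge may be the reverse of the first: this is what the diagonal of the nonbacktracking
    matrices counts. *)
Definition closed_walks k : {set 'I_n * k.-tuple 'I_n} :=
  [set q : 'I_n * k.-tuple 'I_n | reduced q.1 q.1 q.2 && (last q.1 q.2 == q.1)].

Definition walk_support k (q : 'I_n * k.-tuple 'I_n) : {set 'I_n} :=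
  [set y in q.1 :: q.2].

Definition closed_count k G : nat :=
  #|[set q in closed_walks k | walk_edges q.1 q.2 \subset G]|.

Lemma card_walks_in k V :
  #|[set q : 'I_n * k.-tuple 'I_n | walk_support q \subset V]| = #|V| ^ k.+1.
Proof.
rewrite expnS -card_tuples_in -cardsX; apply: eq_card => -[x s]; rewrite !inE /=.
apply/subsetP/andP => [h|[xV /allP sV] y].
  by split; [|apply/allP => y ys]; apply: h; rewrite !inE ?eqxx ?ys ?orbT.
by rewrite !inE => /orP[/eqP-> //|/sV].
Qed.

(** Choose the joint support, one of C(n, v) <= n^v sets, then the 2(k + 1) entries of the two
    sequences inside it. *)
Lemma card_walk_pairs_le k v :
  #|[set q : ('I_n * k.-tuple 'I_n) * ('I_n * k.-tuple 'I_n) |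
      #|walk_support q.1 :|: walk_support q.2| == v]| <= n ^ v * v ^ (2 * k.+1).
Proof.
rewrite -sum1_card.
rewrite (partition_big (fun q => walk_support q.1 :|: walk_support q.2)
           (fun V => V \in [set V : {set 'I_n} | #|V| == v])) /=; last first.
  by move=> q; rewrite !inE.
apply: leq_trans (_ : \sum_(V in [set V : {set 'I_n} | #|V| == v]) v ^ (2 * k.+1) <= _).
  apply: leq_sum => V; rewrite inE => /eqP Vv; rewrite sum1_card mul2n -addnn expnD -Vv.
  rewrite -card_walks_in -cardsX; apply/subset_leq_card/subsetP => q.
  rewrite !inE => /andP[_ /eqP <-]; by rewrite subsetUl subsetUr.
rewrite sum_nat_const card_draws card_ord leq_mul2r; apply/orP; right.
apply: leq_trans (_ : 'C(n, v) * v`! <= _); first by rewrite leq_pmulr // fact_gt0.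
rewrite bin_ffact; elim: v => [|v IH]; first by rewrite ffactn0 expn0.
by rewrite ffactnSr expnSr leq_mul // leq_subr.
Qed.

Lemma card_walk_support k (q : 'I_n * k.-tuple 'I_n) : #|walk_support q| <= k.+1.
Proof.
apply: leq_trans (_ : size (q.1 :: q.2) <= _); last by rewrite /= size_tuple.
by rewrite cardsE card_size.
Qed.

(** The second moment sums [copies] over unions of two walks. With v vertices there are at most n^v
    v^(2k+2) pairs, each present in at most a fraction (2d/n)^v of the graphs. The powers of n
    cancel, and v takes at most 2k + 3 values. *)
Lemma closed_count_moment2 d k : 0 < d -> 0 < k -> 2 * d <= n ->
  2 * (2 * (2 * k) + 2 * d ^ 2 + 2 * d) <= n * d ->
  \sum_(G in regular_graphs n d) closed_count k G ^ 2
    <= (2 * k.+1).+1 * (4 * k.+1 * d) ^ (2 * k.+1) * #|regular_graphs n d|.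
Proof.
move=> d_gt0 k_gt0 dn hn.
pose C := setX (closed_walks k) (closed_walks k).
pose E (q : ('I_n * k.-tuple 'I_n) * ('I_n * k.-tuple 'I_n)) :=
  walk_edges q.1.1 q.1.2 :|: walk_edges q.2.1 q.2.2.
pose S (q : ('I_n * k.-tuple 'I_n) * ('I_n * k.-tuple 'I_n)) :=
  walk_support q.1 :|: walk_support q.2.
set o := #|regular_graphs n d|.
have -> : \sum_(G in regular_graphs n d) closed_count k G ^ 2 = \sum_(q in C) copies d (E q).
  transitivity (\sum_(G in regular_graphs n d) \sum_(q in C) (E q \subset G)).
    apply: eq_bigr => G _; rewrite -mulnn -cardsX -sum1_card big_mkcond [RHS]big_mkcond.
    apply: eq_bigr => -[q1 q2] _; rewrite /C !in_setX /E subUset.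
    rewrite !(in_set (fun q => (q \in closed_walks k) && _)).
    by case: (q1 \in _); case: (q2 \in _) => //=; rewrite ?andbF //; case: (_ && _).
  rewrite exchange_big; apply: eq_bigr => q _.
  rewrite /copies -sum1_card big_mkcond [RHS]big_mkcond; apply: eq_bigr => G _.
  by rewrite [in RHS]in_set; case: (G \in _) => //=; case: (_ \subset _).
have SW q : #|S q| <= 2 * k.+1.
  by rewrite mul2n -addnn; apply: leq_trans (leq_card_setU _ _).1 (leq_add _ _);
     apply: card_walk_support.
have cE x s : #|walk_edges x s| <= size s.
  elim: s x => [|z s IH] x /=; first by rewrite cards0.
  by rewrite cardsU1; case: (_ \notin _); rewrite /= ?add1n ?ltnS ?add0n // (leq_trans (IH z)).
have n_gt0 : 0 < n by lia.
(* Since 2d <= n, the exponent can be lowered from the number of edges to the number of vertices. *)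
have gen c e v : v <= e -> c * n ^ e <= (2 * d) ^ e * o -> c * n ^ v <= (2 * d) ^ v * o.
  move=> /subnK <-; move: (e - v) => j; rewrite !expnD !(mulnA c) [c * n ^ j]mulnC -!mulnA.
  move=> h; rewrite -(@leq_pmul2l (n ^ j)) ?expn_gt0 ?n_gt0 //.
  apply: leq_trans h _; rewrite leq_mul2r; apply/orP; right.
  by case: j => // j; rewrite leq_exp2r.
have bound q : q \in C -> copies d (E q) * n ^ #|S q| <= (2 * d) ^ #|S q| * o.
  case: q => -[x1 s1] [x2 s2]; rewrite !inE /= => /andP[/andP[r1 /eqP l1] /andP[r2 /eqP l2]].
  have SE : #|S (x1, s1, (x2, s2))| <= #|E (x1, s1, (x2, s2))|.
    by apply: excess_closed2; rewrite // -size_eq0 size_tuple -lt0n.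
  have Ek : #|E (x1, s1, (x2, s2))| <= (2 * k).+1.
    apply: leq_trans (leq_card_setU _ _).1 _; rewrite mul2n -addnn leqW // leq_add //.
      by apply: leq_trans (cE _ _) _; rewrite size_tuple.
    by apply: leq_trans (cE _ _) _; rewrite size_tuple.
  exact: gen SE (copies_le d_gt0 hn Ek).
(* [inord] loses nothing: by [SW] the support has at most 2(k + 1) vertices. *)
rewrite (partition_big (fun q => inord #|S q| : 'I_(2 * k.+1).+1) predT) //=.
apply: leq_trans (_ : \sum_(v < (2 * k.+1).+1) (4 * k.+1 * d) ^ (2 * k.+1) * o <= _);
  last by rewrite sum_nat_const card_ord mulnA.
apply: leq_sum => v _; have vW : v <= 2 * k.+1 by rewrite -ltnS.
rewrite -(@leq_pmul2l (n ^ v)) ?expn_gt0 ?n_gt0 //.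
rewrite big_distrr /=.
apply: leq_trans (_ : \sum_(q | #|S q| == v) (2 * d) ^ v * o <= _).
  rewrite [leqRHS]big_mkcond [leqLHS]big_mkcond; apply: leq_sum => q _.
  case: ifP => // /andP[qC /eqP/(congr1 val)]; rewrite /= inordK ?ltnS // => Sv.
  by rewrite Sv eqxx mulnC -Sv; apply: bound.
rewrite sum_nat_const mulnA [leqRHS]mulnA leq_mul2r; apply/orP; right.
apply: leq_trans (_ : n ^ v * v ^ (2 * k.+1) * (2 * d) ^ v <= _).
  rewrite leq_mul2r -[X in X <= _]cardsE; apply/orP; right.
  exact: card_walk_pairs_le.
rewrite -mulnA leq_mul2l; apply/orP; right.
have -> : 4 * k.+1 * d = (2 * k.+1) * (2 * d) by lia.
rewrite [leqRHS]expnMn; apply: leq_mul; first by rewrite leq_exp2r.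
by apply: leq_pexp2l => //; rewrite muln_gt0.
Qed.

End Walks.

(** * Recurrence for nonbacktracking walk counts *)

Section WalkRecurrence.
Variables (n d : nat) (G : {set {set 'I_n}}).
Hypothesis rG : G \in regular_graphs n d.
Implicit Types (p x y z : 'I_n).

Definition walk_count k p x y : nat :=
  #|[set s : k.-tuple 'I_n | [&& reduced p x s, walk_edges x s \subset G & last x s == y]]|.

Lemma walk_count0 p x y : walk_count 0 p x y = (x == y).
Proof.
rewrite /walk_count -sum1_card big_mkcond /=.
rewrite (bigD1 [tuple]) //= big1 => [|s]; last by rewrite tuple0.
by rewrite addn0 inE /= sub0set; case: eqP.
Qed.

Lemma walk_countS k p x y :
  walk_count k.+1 p x y =
  \sum_z ([set x; z] \in G) * (z != p) * walk_count k x z y.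
Proof.
rewrite /walk_count -sum1_card big_mkcond /= sum_tuple_cons; apply: eq_bigr => z _.
under eq_bigr do rewrite inE /= subUset sub1set.
case: (boolP (_ \in G)) => [xz|]; last first.
  by rewrite !mul0n => _; rewrite big1 // => s _; rewrite /= !andbF.
have zx : z != x by rewrite eq_sym (edge_neq rG xz).
case: (z =P p) => [->|_]; first by rewrite muln0 mul0n big1 // => s _; rewrite /= andbF.
rewrite !mul1n -sum1_card [RHS]big_mkcond /=; apply: eq_bigr => s _.
by rewrite inE zx.
Qed.

Lemma walk_countE k x y :
  walk_count k.+1 x x y = \sum_z ([set x; z] \in G) * walk_count k x z y.
Proof.
rewrite walk_countS; apply: eq_bigr => z _; case: (boolP (_ \in G)) => //= xz.
by rewrite eq_sym (edge_neq rG xz) muln1.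
Qed.

(** Walks without a past are split according to whether their first step goes to [p]. *)
Lemma walk_count_backtrack k p x y :
  walk_count k.+1 x x y =
  walk_count k.+1 p x y + ([set x; p] \in G) * walk_count k x p y.
Proof.
rewrite walk_countE walk_countS (bigD1 p) //= [in RHS](bigD1 p) //= eqxx muln0 mul0n add0n.
rewrite addnC; congr (_ + _); apply: eq_bigr => z zp.
by rewrite zp muln1.
Qed.

(** Prepending the edge xz to a walk from z keeps it reduced unless it steps straight back to x;
    what then remains is a walk from [x] with past [z]. *)
Lemma walk_count_step k x y :
  \sum_z ([set x; z] \in G) * walk_count k.+1 z z y =
  walk_count k.+2 x x y + \sum_z ([set x; z] \in G) * walk_count k z x y.
Proof.
rewrite walk_countE -big_split /=; apply: eq_bigr => z _.
rewrite (walk_count_backtrack k x z y) mulnDr mulnA (setUC [set z]).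
by case: (_ \in G).
Qed.

Lemma sum_adj x : \sum_z ([set x; z] \in G) = d.
Proof.
rewrite -(card_neighbors x rG) -sum1_card [RHS]big_mkcond /=.
by apply: eq_bigr => z _; rewrite inE; case: (_ \in G).
Qed.

Lemma walk_count_rec0 x y :
  \sum_z ([set x; z] \in G) * walk_count 1 z z y = walk_count 2 x x y + d * walk_count 0 x x y.
Proof.
rewrite walk_count_step; congr (_ + _).
by rewrite -{1}(sum_adj x) big_distrl; apply: eq_bigr => z _; rewrite !walk_count0.
Qed.

(** Summed over the d possible pasts z, a nonempty walk from x is counted d - 1 times: only its own
    first step is a forbidden past. Moving one term to the left avoids a subtraction in [nat]. *)
Lemma walk_count_rec k x y :
  \sum_z ([set x; z] \in G) * walk_count k.+2 z z y + walk_count k.+1 x x y =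
  walk_count k.+3 x x y + d * walk_count k.+1 x x y.
Proof.
rewrite walk_count_step -addnA; congr (_ + _).
rewrite -{1}(sum_adj x) big_distrl /= [walk_count k.+1 x x y]walk_countE -big_split /=.
apply: eq_bigr => z _; case: (boolP (_ \in G)) => // xz; rewrite !mul1n.
by rewrite -walk_countE (walk_count_backtrack k z x y) xz mul1n.
Qed.

End WalkRecurrence.

(* Imported only here because [classical_sets] shadows the names of [finset]. *)
From mathcomp Require Import all_classical all_reals all_analysis.
From mathcomp Require Import measurable_realfun complex.
Import numFieldNormedType.Exports.
Local Open Scope ring_scope.

(** * Chebyshev polynomials of the adjacency matrix *)

Section Chebyshev.
Variable R : comNzRingType.

Fixpoint cheb_pair k : {poly R} * {poly R} :=
  if k is k'.+1 then ((cheb_pair k').2, 'X * (cheb_pair k').2 - (cheb_pair k').1)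
  else (1, 'X).

(* The Chebyshev polynomial [U_k (x / 2)]. *)
Definition cheb k : {poly R} := (cheb_pair k).1.

Lemma cheb0 : cheb 0 = 1. Proof. by []. Qed.
Lemma cheb1 : cheb 1 = 'X. Proof. by []. Qed.
Lemma chebS k : cheb k.+2 = 'X * cheb k.+1 - cheb k. Proof. by []. Qed.

Lemma cheb_ind (P : nat -> Prop) :
  P 0%N -> P 1%N -> (forall k, P k -> P k.+1 -> P k.+2) -> forall k, P k.
Proof.
move=> P0 P1 PS k; suff [] : P k /\ P k.+1 by [].
by elim: k => [|k [Pk PSk]]; split=> //; apply: PS.
Qed.

Lemma cheb_size_monic k : size (cheb k) = k.+1 /\ cheb k \is monic.
Proof.
elim/cheb_ind: k => [||k [sk mk] [sk1 mk1]].
- by rewrite cheb0 size_poly1 monic1.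
- by rewrite cheb1 size_polyX monicX.
have sX : size ('X * cheb k.+1) = k.+3.
  by rewrite mulrC size_mulX ?sk1 // monic_neq0.
have lt : (size (- cheb k)%R < size ('X * cheb k.+1)%R)%N by rewrite size_polyN sk sX ltnW.
split; first by rewrite chebS size_polyDl // sX.
by rewrite monicE chebS lead_coefDl // mulrC lead_coefMX -monicE.
Qed.

Lemma size_cheb k : size (cheb k) = k.+1. Proof. by case: (cheb_size_monic k). Qed.
Lemma cheb_monic k : cheb k \is monic. Proof. by case: (cheb_size_monic k). Qed.

Lemma cheb_horner k x : (cheb k.+2).[x] = x * (cheb k.+1).[x] - (cheb k).[x].
Proof. by rewrite chebS hornerD hornerN hornerM hornerX. Qed.

Lemma cheb_opp k x : (cheb k).[- x] = (-1) ^+ k * (cheb k).[x].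
Proof.
elim/cheb_ind: k => [||k IH0 IH1].
- by rewrite cheb0 !hornerC expr0 mulr1.
- by rewrite cheb1 !hornerX expr1 mulN1r.
by rewrite !cheb_horner IH0 IH1 !exprS; ring.
Qed.

Lemma cheb_decomp (p : {poly R}) m : (size p <= m)%N ->
  exists c : nat -> R, p = \sum_(k < m) c k *: cheb k.
Proof.
elim: m p => [|m IH] p.
  by rewrite leqn0 size_poly_eq0 => /eqP->; exists (fun=> 0); rewrite big_ord0.
move=> sp; have [|c Ec] := IH (p - p`_m *: cheb m).
  apply/leq_sizeP => j; rewrite leq_eqVlt => /orP[/eqP<-|mj].
    have := cheb_monic m; rewrite monicE lead_coefE size_cheb /= => /eqP E.
    by rewrite coefB coefZ E mulr1 subrr.
  by rewrite coefB coefZ (nth_default _ (leq_trans sp mj)) [(cheb m)`_j]nth_default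
       ?size_cheb // mulr0 subrr.
exists (fun k => if k == m then p`_m else c k); rewrite big_ord_recr /= eqxx.
rewrite (eq_bigr (fun k : 'I_m => c k *: cheb k)) -?Ec ?subrK // => k _.
by rewrite ltn_eqF.
Qed.

End Chebyshev.

Section ChebMx.
Variables (F : comNzRingType) (n : nat).
Implicit Types B P : 'M[F]_n.

Fixpoint cheb_mx_pair B k : 'M[F]_n * 'M[F]_n :=
  if k is k'.+1 then ((cheb_mx_pair B k').2, B *m (cheb_mx_pair B k').2 - (cheb_mx_pair B k').1)
  else (1%:M, B).

Definition cheb_mx B k : 'M[F]_n := (cheb_mx_pair B k).1.

Lemma cheb_mx0 B : cheb_mx B 0 = 1%:M. Proof. by []. Qed.
Lemma cheb_mx1 B : cheb_mx B 1 = B. Proof. by []. Qed.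
Lemma cheb_mxS B k : cheb_mx B k.+2 = B *m cheb_mx B k.+1 - cheb_mx B k. Proof. by []. Qed.

Lemma cheb_mx_conj P Q B k : P *m Q = 1%:M ->
  cheb_mx (Q *m B *m P) k = Q *m cheb_mx B k *m P.
Proof.
move=> PQ; have QP := mulmx1C PQ.
elim/cheb_ind: k => [||k IH0 IH1] //; first by rewrite !cheb_mx0 mulmx1.
rewrite !cheb_mxS IH0 IH1 mulmxBr mulmxBl; congr (_ - _).
by rewrite -!mulmxA (mulmxA P) PQ mul1mx.
Qed.

Lemma cheb_mx_diag (d : 'rV[F]_n) k :
  cheb_mx (diag_mx d) k = diag_mx (\row_i (cheb F k).[d 0 i]).
Proof.
elim/cheb_ind: k => [||k IH0 IH1].
- by rewrite cheb_mx0; apply/matrixP => i j; rewrite !mxE cheb0 hornerC.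
- by rewrite cheb_mx1; apply/matrixP => i j; rewrite !mxE cheb1 hornerX.
rewrite cheb_mxS IH0 IH1 mulmx_diag -raddfB; congr diag_mx.
by apply/rowP => i; rewrite !mxE cheb_horner.
Qed.

End ChebMx.

Lemma map_cheb_mx (F K : comNzRingType) (f : {rmorphism F -> K}) n (B : 'M[F]_n) k :
  map_mx f (cheb_mx B k) = cheb_mx (map_mx f B) k.
Proof.
elim/cheb_ind: k => [||k IH0 IH1] //; first by rewrite !cheb_mx0 map_mx1.
by rewrite !cheb_mxS map_mxB map_mxM IH0 IH1.
Qed.

Lemma rmorph_cheb (F K : comNzRingType) (f : {rmorphism F -> K}) x k :
  (cheb K k).[f x] = f (cheb F k).[x].
Proof.
elim/cheb_ind: k => [||k IH0 IH1].
- by rewrite !cheb0 !hornerC rmorph1.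
- by rewrite !cheb1 !hornerX.
by rewrite !cheb_horner IH0 IH1 rmorphB rmorphM.
Qed.

Section ChebyshevMatrix.
Variables (R : realType) (n d : nat) (G : {set {set 'I_n}}).
Hypothesis rG : G \in regular_graphs n d.

Let NB k : 'M[R]_n := \matrix_(x, y) (walk_count G k x x y)%:R.
Let A := adjacency R G.

Lemma adj_mulNB k x y : (A *m NB k) x y =
  (\sum_z ([set x; z] \in G) * walk_count G k z z y)%N%:R.
Proof. by rewrite mxE natr_sum; apply: eq_bigr => z _; rewrite !mxE natrM. Qed.

Lemma NB0 : NB 0 = 1%:M.
Proof. by apply/matrixP => x y; rewrite !mxE walk_count0. Qed.

Lemma NB1 : NB 1 = A.
Proof.
apply/matrixP => x y; rewrite !mxE (walk_countE rG) (bigD1 y) //= big1 => [|z zy].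
  by rewrite walk_count0 eqxx muln1 addn0.
by rewrite walk_count0 (negPf zy) muln0.
Qed.

Fixpoint NB_sum k : 'M[R]_n := match k with
  | 0 => NB 0 | 1 => NB 1 | k'.+2 => NB_sum k' + NB k end.

(** The matrices [NB] have a three-term recurrence with factor d - 1, except at the bottom, where
    the factor is d. Summing over one parity turns the surplus [NB 0] into part of [NB_sum 2], and
    the recurrence becomes uniform, hence Chebyshev after rescaling. *)
Lemma NB_sum_rec k : A *m NB_sum k.+1 = NB_sum k.+2 + (d%:R - 1) *: NB_sum k.
Proof.
have r0 : A *m NB 1 = NB 2 + d%:R *: NB 0.
  apply/matrixP => x y; rewrite adj_mulNB (walk_count_rec0 rG) !mxE natrD natrM.
  by [].
have rS j : A *m NB j.+2 = NB j.+3 + (d%:R - 1) *: NB j.+1.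
  apply/matrixP => x y; rewrite adj_mulNB !mxE.
  have /(congr1 (fun m => m%:R : R)) := walk_count_rec rG j x y.
  by rewrite !natrD natrM => /(canRL (addrK _)) ->; ring.
elim/cheb_ind: k => [||k IH _].
- rewrite /= r0; move: (NB 0) (NB 2) => P Q.
  by apply/matrixP => x y; rewrite !mxE; ring.
- rewrite [NB_sum 2]/= mulmxDr rS NB0 mulmx1 -NB1 /=; move: (NB 1) (NB 3) => P Q.
  by apply/matrixP => x y; rewrite !mxE; ring.
rewrite [NB_sum k.+3]/= mulmxDr IH rS /=.
move: (NB_sum k) (NB k.+4) (NB k.+2) => P Q S.
by apply/matrixP => x y; rewrite !mxE; ring.
Qed.

Lemma cheb_mx_NB (s : R) k : s != 0 -> s ^+ 2 = d%:R - 1 ->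
  s ^+ k *: cheb_mx (s^-1 *: A) k = NB_sum k.
Proof.
move=> s0 s2; elim/cheb_ind: k => [||k IH0 IH1].
- by rewrite expr0 scale1r /= NB0.
- by rewrite expr1 /cheb_mx /= scalerA divff // scale1r NB1.
rewrite cheb_mxS scalerBr -scalemxAl scalerA.
have -> : s ^+ k.+2 / s = s ^+ k.+1 by rewrite exprSr mulfK.
rewrite scalemxAr IH1 NB_sum_rec; have -> : s ^+ k.+2 = (d%:R - 1) * s ^+ k by rewrite -s2 -exprD.
by rewrite -scalerA IH0 addrK.
Qed.

Lemma tr_NB k : \tr (NB k) = (closed_count k G)%:R.
Proof.
rewrite /mxtrace; under eq_bigr do rewrite mxE; rewrite -natr_sum; congr (_%:R).
rewrite /closed_count -sum1_card; under eq_bigr do rewrite /walk_count -sum1_card.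
rewrite pair_big_dep /=; apply: eq_bigl => q; rewrite !inE.
by rewrite -!andbA; case: (reduced _ _ _) => //=; rewrite andbC.
Qed.

Lemma closed_count0 : closed_count 0 G = n.
Proof.
apply/eqP; rewrite -(eqr_nat R) -tr_NB NB0 mxtrace1 //.
Qed.

(** Walks of length 0 occur only for even k and contribute n; the positive lengths of one parity are
    bounded by all lengths. *)
Lemma tr_NB_sum k : `|\tr (NB_sum k)| <=
  (if odd k then 0 else n%:R) + \sum_(1 <= j < k.+1) (closed_count j G)%:R.
Proof.
have ge0 a b : 0 <= \sum_(a <= j < b) (closed_count j G)%:R :> R by apply: sumr_ge0.
elim/cheb_ind: k => [||k IH0 _].
- by rewrite /= tr_NB closed_count0 big_nil addr0 ger0_norm.
- by rewrite /= tr_NB big_nat1 add0r ger0_norm.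
rewrite /= mxtraceD tr_NB negbK big_nat_recr //= addrA.
apply: le_trans (ler_normD _ _) _; rewrite (ger0_norm (ler0n _ _)) lerD2r.
by rewrite big_nat_recr //= addrA (le_trans IH0) // lerDl.
Qed.

Lemma tr_cheb_mx (s : R) k : 0 < s -> s ^+ 2 = d%:R - 1 ->
  `|\tr (cheb_mx (s^-1 *: adjacency R G) k)| <=
  s ^- k * ((if odd k then 0 else n%:R) + \sum_(1 <= j < k.+1) (closed_count j G)%:R).
Proof.
move=> s0 s2; have sk : 0 < s ^+ k by rewrite exprn_gt0.
rewrite -(ler_pM2l sk) mulrA divff ?gt_eqF // mul1r.
rewrite -{1}(gtr0_norm sk) -normrM -mxtraceZ cheb_mx_NB ?gt_eqF //.
exact: tr_NB_sum.
Qed.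

End ChebyshevMatrix.

(** * Chebyshev-Markov-Stieltjes majorants *)

Section Majorant.
Variable R : realFieldType.
Implicit Types (C s : seq R) (p q g h : {poly R}).

Definition prod_subX C : {poly R} := \prod_(c <- C) (c%:P - 'X).
Definition prod_Xsub s : {poly R} := \prod_(a <- s) ('X - a%:P).

(* The functions [h / prod_subX C] with [cone C h] are the nonnegative
   combinations of the products of 1 / (c - x) over the suffixes of C; they are
   closed under taking divided differences at points to the left of C. *)
Fixpoint cone C h : Prop :=
  if C is c :: C' then
    exists a h', [/\ 0 <= a, cone C' h' & h = a%:P + (c%:P - 'X) * h']
  else exists a, 0 <= a /\ h = a%:P.

Lemma coneD C h1 h2 : cone C h1 -> cone C h2 -> cone C (h1 + h2).
Proof.
elim: C h1 h2 => [|c C IH] h1 h2 /=.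
  by case=> a [a0 ->] [b [b0 ->]]; exists (a + b); rewrite addr_ge0 // polyCD.
case=> a [h1' [a0 ch1 ->]] [b [h2' [b0 ch2 ->]]]; exists (a + b), (h1' + h2').
by split; [exact: addr_ge0 | exact: IH | rewrite polyCD; ring].
Qed.

Lemma coneZ C h a : 0 <= a -> cone C h -> cone C (a%:P * h).
Proof.
move=> a0; elim: C h => [|c C IH] h /=.
  by case=> b [b0 ->]; exists (a * b); rewrite mulr_ge0 // polyCM.
case=> b [h' [b0 ch ->]]; exists (a * b), (a%:P * h').
by split; [exact: mulr_ge0 | exact: IH | rewrite polyCM; ring].
Qed.

Lemma cone1 C : cone C 1.
Proof.
have cone0 D : cone D 0.
  by elim: D => [|c D IH]; [exists 0 | exists 0, 0; split; rewrite ?mulr0 ?addr0].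
by case: C => [|c C]; [exists 1 | exists 1, 0; split; rewrite ?mulr0 ?addr0].
Qed.

Lemma cone_ge0 C h x : cone C h -> (forall c, c \in C -> x <= c) -> 0 <= h.[x].
Proof.
elim: C h => [|c C IH] h /=; first by case=> a [a0 ->] _; rewrite hornerC.
case=> a [h' [a0 ch ->]] xC; rewrite !hornerE addr_ge0 // mulr_ge0 //.
  by rewrite subr_ge0 xC // mem_head.
by apply: IH => // b bC; rewrite xC // inE bC orbT.
Qed.

(** Divided difference of 1 / prod_subX C at b, built factor by factor from 1/(c - x) - 1/(c - b) =
    (x - b) / ((c - x)(c - b)). *)
Lemma cone_diff1 C b : (forall c, c \in C -> b < c) ->
  exists t k, [/\ 0 <= t, cone C k & 1 - t%:P * prod_subX C = ('X - b%:P) * k].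
Proof.
elim: C => [|c C IH] bC.
  exists 1, 0; split; [exact: ler01 | by exists 0 |].
  by rewrite /prod_subX big_nil mulr1 subrr mulr0.
have [|t [k [t0 ck E]]] := IH; first by move=> a aC; rewrite bC // inE aC orbT.
have bc : 0 < c - b by rewrite subr_gt0 bC // mem_head.
have u0 : 0 <= (c - b)^-1 by rewrite invr_ge0 ltW.
exists (t * (c - b)^-1), ((c - b)^-1%:P + (c%:P - 'X) * ((c - b)^-1%:P * k)).
split; [exact: mulr_ge0 | |].
  by exists (c - b)^-1, ((c - b)^-1%:P * k); split=> //; apply: coneZ.
have E1 : (c - b)^-1%:P * (c%:P - b%:P) = 1 :> {poly R}.
  by rewrite -polyCB -polyCM mulVf // gt_eqF.
rewrite {1}/prod_subX big_cons -/(prod_subX C) polyCM.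
have -> : t%:P * (c - b)^-1%:P * ((c%:P - 'X) * prod_subX C) =
  (c - b)^-1%:P * (c%:P - 'X) * (1 - ('X - b%:P) * k) by rewrite -E; ring.
by rewrite -[X in X - _]E1; ring.
Qed.

(** Here [t] is the value of h / prod_subX C at b, and k / prod_subX C is the divided difference. *)
Lemma cone_diff C h b : (forall c, c \in C -> b < c) -> cone C h ->
  exists t k, [/\ 0 <= t, cone C k & h - t%:P * prod_subX C = ('X - b%:P) * k].
Proof.
elim: C h => [|c C IH] h bC.
  case=> a [a0 ->]; exists a, 0; split=> //; first by exists 0.
  by rewrite /prod_subX big_nil mulr1 subrr mulr0.
case=> a [h' [a0 ch ->]].
have [t1 [k1 [t10 ck1 E1]]] := cone_diff1 bC.
have [||t2 [k2 [t20 ck2 E2]]] := IH h' => //.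
  by move=> e eC; rewrite bC // inE eC orbT.
exists (a * t1 + t2), (a%:P * k1 + (c%:P - 'X) * k2); split.
- by rewrite addr_ge0 // mulr_ge0.
- apply: coneD; first exact: coneZ.
  by exists 0, k2; split; rewrite ?add0r.
rewrite polyCD polyCM.
have -> : ('X - b%:P) * (a%:P * k1 + (c%:P - 'X) * k2) =
  a%:P * (('X - b%:P) * k1) + (c%:P - 'X) * (('X - b%:P) * k2) by ring.
by rewrite -E1 -E2 /prod_subX big_cons; ring.
Qed.

(* Newton interpolation of [1 / prod_subX C] at the nodes s: all the divided
   differences are nonnegative. *)
Lemma newton_cone C s : (forall a c, a \in s -> c \in C -> a < c) ->
  exists g h, [/\ (size g <= size s)%N, cone C h,
    forall x, (forall a, a \in s -> a <= x) -> 0 <= g.[x] &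
    1 - g * prod_subX C = prod_Xsub s * h].
Proof.
elim/last_ind: s => [|s b IH] sC.
  exists 0, 1; split; [by rewrite size_poly0 | exact: cone1 | by move=> x _; rewrite horner0 |].
  by rewrite /prod_Xsub big_nil mul0r subr0 mulr1.
have [|g [h [sg ch g0 E]]] := IH.
  by move=> a c aS cC; rewrite sC // mem_rcons inE aS orbT.
have [||t [k [t0 ck E2]]] := @cone_diff C h b => //.
  by move=> c cC; rewrite sC // mem_rcons mem_head.
(* Newton's step: [t] is the next divided difference, multiplying the product over the earlier
   nodes. *)
exists (g + t%:P * prod_Xsub s), k; split=> //.
- rewrite size_rcons (leq_trans (size_polyD _ _)) // geq_max (leq_trans sg) //=.
  rewrite mul_polyC (leq_trans (size_scale_leq _ _)) // /prod_Xsub.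
  by rewrite size_prod_XsubC.
- move=> x xs; rewrite !hornerE addr_ge0 //.
    by apply: g0 => a aS; rewrite xs // mem_rcons inE aS orbT.
  rewrite mulr_ge0 // horner_prod big_seq prodr_ge0 // => a aS.
  by rewrite !hornerE subr_ge0 xs // mem_rcons inE aS orbT.
rewrite mulrDl opprD addrA E /prod_Xsub -cats1 big_cat big_seq1 /= -/(prod_Xsub s).
by rewrite -[RHS]mulrA -E2; ring.
Qed.

Lemma size_prod_subX C : (size (prod_subX C) <= (size C).+1)%N.
Proof.
elim: C => [|c C IH]; first by rewrite /prod_subX big_nil size_poly1.
rewrite /prod_subX big_cons; apply: leq_trans (size_polyMleq _ _) _.
have -> : c%:P - 'X = - ('X - c%:P) by rewrite opprB.
by rewrite size_polyN size_XsubC.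
Qed.

(** Take q = g P with P the squared product over [U], and g interpolating 1/P at y and at the
    doubled points of [L]. Then 1 - q is (x - y) times a square times an h that is nonnegative to
    the left of [U], so q >= 1 up to y. Beyond y, g >= 0 because all nodes are at most y and the
    Newton coefficients are nonnegative. *)
Lemma markov_stieltjes (L U : seq R) y :
  (forall a, a \in L -> a < y) -> (forall a, a \in U -> y < a) ->
  exists q : {poly R}, [/\ (size q <= (size L + size U).*2.+1)%N,
    forall x, 0 <= q.[x], forall x, x <= y -> 1 <= q.[x],
    forall a, a \in y :: L -> q.[a] = 1 & forall a, a \in U -> q.[a] = 0].
Proof.
move=> Ly yU; pose s := y :: (L ++ L); pose C := U ++ U.
have sy a : a \in s -> a <= y.
  by rewrite inE mem_cat orbb => /orP[/eqP-> //|/Ly/ltW].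
have Cy c : c \in C -> y < c by rewrite mem_cat orbb; apply: yU.
have [|g [h [sg ch g0 E]]] := @newton_cone C s.
  by move=> a c /sy ay /Cy; apply: le_lt_trans.
have PU x : (prod_subX C).[x] = (prod_subX U).[x] ^+ 2.
  by rewrite /prod_subX big_cat hornerM expr2.
have PL x : (prod_Xsub s).[x] = (x - y) * (prod_Xsub L).[x] ^+ 2.
  by rewrite /prod_Xsub big_cons big_cat !hornerM hornerXsubC expr2.
have qE x : 1 - (g * prod_subX C).[x] = (x - y) * (prod_Xsub L).[x] ^+ 2 * h.[x].
  by rewrite -PL -hornerM -E !hornerE.
have q1 x : x <= y -> 1 <= (g * prod_subX C).[x].
  move=> xy; rewrite -subr_le0 qE -mulrA mulr_le0_ge0 ?subr_le0 //.
  rewrite mulr_ge0 ?sqr_ge0 // (cone_ge0 ch) // => c /Cy/ltW; exact: le_trans.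
exists (g * prod_subX C); split=> //.
- have := size_polyMleq g (prod_subX C); have := size_prod_subX C.
  rewrite /C /s /= !size_cat in sg *; lia.
- move=> x; case: (lerP x y) => [/q1|yx]; first exact: le_trans.
  rewrite hornerM PU mulr_ge0 ?sqr_ge0 // g0 // => a /sy ay; exact: le_trans ay (ltW yx).
- move=> a; rewrite inE => /orP[/eqP->|aL]; apply/esym/eqP; rewrite -subr_eq0 qE.
    by rewrite subrr !mul0r.
  have /rootP -> : root (prod_Xsub L) a by rewrite root_prod_XsubC.
  by rewrite expr0n mulr0 mul0r.
move=> a aU; rewrite hornerM PU.
have -> : (prod_subX U).[a] = 0; last by rewrite expr0n mulr0.
apply/eqP; rewrite horner_prod prodf_seq_eq0; apply/hasP; exists a => //=.
by rewrite !hornerE subrr.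
Qed.
End Majorant.

(** * Gauss-Chebyshev quadrature *)

Section Quadrature.
Variable R : realType.
Implicit Types (m i j k : nat) (x t : R) (p : {poly R}).

Lemma cos_natpi k : cos (k%:R * pi) = (-1) ^+ k :> R.
Proof.
elim: k => [|k IH]; first by rewrite mul0r cos0.
by rewrite -natr1 mulrDl mul1r cosDpi IH exprS mulN1r.
Qed.

Lemma sin_natpi k : sin (k%:R * pi) = 0 :> R.
Proof.
elim: k => [|k IH]; first by rewrite mul0r sin0.
by rewrite -natr1 mulrDl mul1r sinDpi IH oppr0.
Qed.

Lemma cheb_sin k t : (cheb R k).[2 * cos t] * sin t = sin (k.+1%:R * t).
Proof.
elim/cheb_ind: k => [||k IH0 IH1].
- by rewrite cheb0 hornerC !mul1r.
- by rewrite cheb1 hornerX (_ : 2%:R * t = t *+ 2) ?sin_mulr2n ?mulr_natl //; ring.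
rewrite cheb_horner mulrBl -mulrA IH1 IH0.
have -> : k.+3%:R * t = k.+2%:R * t + t by rewrite -[k.+3%:R]natr1; ring.
have -> : k.+1%:R * t = k.+2%:R * t - t by rewrite -[k.+2%:R]natr1; ring.
by rewrite sinB sinD; ring.
Qed.

Lemma sin_nat_le k t : `|sin (k%:R * t)| <= k%:R * `|sin t|.
Proof.
elim: k => [|k IH]; first by rewrite mul0r sin0 normr0 mul0r.
rewrite -natr1 !mulrDl !mul1r sinD (le_trans (ler_normD _ _)) // lerD // normrM.
  by rewrite (le_trans _ IH) // ler_piMr // cos_max.
by rewrite ler_piMl // cos_max.
Qed.

Lemma cheb_le k t : sin t != 0 -> `|(cheb R k).[2 * cos t]| <= k.+1%:R.
Proof.
move=> t0; rewrite -(@ler_pM2r _ `|sin t|) ?normr_gt0 //.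
by rewrite -normrM cheb_sin sin_nat_le.
Qed.

(** For 1 <= i <= m the nodes are the zeros of U_m(x/2). Index 0 has weight 0 and is kept so that
    the cosine sums start at angle 0. *)
Definition node_angle m i : R := i%:R * pi / m.+1%:R.
Definition node m i : R := 2 * cos (node_angle m i).
Definition weight m i : R := 2 / m.+1%:R * sin (node_angle m i) ^+ 2.
Definition quadrature m p : R := \sum_(i < m.+1) weight m i * p.[node m i].

(** Multiplication by 2 sin f, where 2f is the angular step, makes the sum telescope. The range of k
    puts f in (0, pi), so sin f is nonzero. *)
Lemma sum_cos_node m k : (0 < k < 2 * m.+1)%N ->
  \sum_(i < m.+1) cos (k%:R * node_angle m i) = (1 - (-1) ^+ k) / 2 :> R.
Proof.
case/andP => k0 km; set f := k%:R * pi / (m.+1%:R * 2) : R.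
have m0 : 0 < m.+1%:R :> R by rewrite ltr0n.
have f0 : 0 < sin f.
  apply: sin_gt0_pi; rewrite /f divr_gt0 ?mulr_gt0 ?ltr0n ?pi_gt0 //=.
  rewrite ltr_pdivrMr ?mulr_gt0 // mulrC ltr_pM2l ?pi_gt0 //.
  by rewrite -natrM ltr_nat mulnC.
have fm : m.+1%:R * (2 * f) = k%:R * pi by rewrite /f; field; rewrite gt_eqF.
have fi i : k%:R * node_angle m i = i%:R * (2 * f).
  by rewrite /f /node_angle; field; rewrite gt_eqF.
have tele N : 2 * sin f * \sum_(i < N) cos (k%:R * node_angle m i) =
   sin (N%:R * (2 * f) - f) + sin f.
  elim: N => [|N IH]; first by rewrite big_ord0 mul0r mulr0 sub0r sinN addNr.
  rewrite big_ord_recr /= mulrDr IH fi -[N.+1%:R]natr1.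
  have -> : (N%:R + 1) * (2 * f) - f = N%:R * (2 * f) + f by ring.
  by rewrite sinB sinD; ring.
apply: (@mulfI _ (2 * sin f)); first by rewrite mulf_neq0 ?gt_eqF.
by rewrite tele fm sinB sin_natpi cos_natpi; field; rewrite ?gt_eqF //.
Qed.

(** The product formula for sines gives cosine sums at the frequencies j - k and j + k + 2. These
    have equal parity, so the sums cancel unless j = k. *)
Lemma quadrature_cheb m j k : (j + k < 2 * m)%N ->
  quadrature m (cheb R j * cheb R k) = (j == k)%:R.
Proof.
wlog kj : j k / (k <= j)%N => [hw|].
  case: (leqP k j) => [kj|/ltnW kj]; first exact: hw.
  by move=> h; rewrite mulrC hw // 1?addnC // eq_sym.
move=> hjk; have m0 : m.+1%:R != 0 :> R by rewrite pnatr_eq0.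
have -> : quadrature m (cheb R j * cheb R k) = m.+1%:R^-1 *
  (\sum_(i < m.+1) cos ((j - k)%:R * node_angle m i) -
   \sum_(i < m.+1) cos ((j + k).+2%:R * node_angle m i)).
  rewrite -sumrB mulr_sumr; apply: eq_bigr => i _; rewrite /weight /node hornerM.
  set t := node_angle m i.
  have -> : (j - k)%:R * t = j.+1%:R * t - k.+1%:R * t.
    by rewrite natrB // -!natr1; ring.
  have -> : (j + k).+2%:R * t = j.+1%:R * t + k.+1%:R * t.
    by rewrite -!natr1 natrD; ring.
  by rewrite cosB cosD -!cheb_sin; field.
rewrite (sum_cos_node (k := (j + k).+2)); last by rewrite /= mulnS; lia.
case: (eqVneq j k) => [->|jk].
  rewrite subnn (eq_bigr (fun=> 1)) => [|i _]; last by rewrite mul0r cos0.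
  rewrite sumr_const card_ord addnn -doubleS -mul2n exprM sqrrN expr1n expr1n.
  by rewrite subrr mul0r subr0 mulVf.
rewrite sum_cos_node; last by apply/andP; split; [rewrite subn_gt0 ltn_neqAle eq_sym jk | lia].
rewrite -signr_odd -[in X in _ - X]signr_odd /= negbK oddD oddB // subrr mulr0.
by [].
Qed.

Lemma weight_ge0 m i : 0 <= weight m i.
Proof. by rewrite mulr_ge0 ?sqr_ge0 ?divr_ge0. Qed.

Lemma weight0 m : weight m 0 = 0.
Proof. by rewrite /weight /node_angle !mul0r sin0 expr0n mulr0. Qed.

Lemma sin_node_gt0 m i : (0 < i <= m)%N -> 0 < sin (node_angle m i).
Proof.
case/andP => i0 im; apply: sin_gt0_pi; rewrite /node_angle divr_gt0 ?mulr_gt0 ?ltr0n ?pi_gt0 //=.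
by rewrite ltr_pdivrMr ?ltr0n // mulrC ltr_pM2l ?pi_gt0 // ltr_nat ltnS.
Qed.

Lemma node_angle_itv m i : (i <= m.+1)%N -> 0 <= node_angle m i <= pi.
Proof.
move=> im; rewrite /node_angle divr_ge0 ?mulr_ge0 ?pi_ge0 //=.
by rewrite ler_pdivrMr ?ltr0n // mulrC ler_pM2l ?pi_gt0 // ler_nat.
Qed.

Lemma ltr_node m i j : (i <= m.+1)%N -> (j <= m.+1)%N -> (node m j < node m i) = (i < j)%N.
Proof.
move=> im jm; rewrite /node ltr_pM2l // ltr_cos ?in_itv /= ?node_angle_itv //.
by rewrite /node_angle ltr_pM2r ?invr_gt0 ?ltr0n // ltr_pM2r ?pi_gt0 // ltr_nat.
Qed.

Lemma node_opp m i : (i <= m.+1)%N -> node m (m.+1 - i) = - node m i.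
Proof.
move=> im; have m0 : m.+1%:R != 0 :> R by rewrite pnatr_eq0.
have -> : node m (m.+1 - i) = 2 * cos (pi - node_angle m i).
  by rewrite /node /node_angle natrB //; congr (_ * cos _); field.
by rewrite cosB cospi sinpi /node; ring.
Qed.

Lemma weight_opp m i : (i <= m.+1)%N -> weight m (m.+1 - i) = weight m i.
Proof.
move=> im; have m0 : m.+1%:R != 0 :> R by rewrite pnatr_eq0.
have -> : weight m (m.+1 - i) = 2 / m.+1%:R * sin (pi - node_angle m i) ^+ 2.
  by rewrite /weight /node_angle natrB //; congr (_ * sin _ ^+ _); field.
by rewrite sinB cospi sinpi /weight; ring.
Qed.

Lemma quadrature_sum m (I : Type) (r : seq I) (F : I -> {poly R}) :
  quadrature m (\sum_(i <- r) F i) = \sum_(i <- r) quadrature m (F i).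
Proof.
rewrite /quadrature exchange_big /=; apply: eq_bigr => i _.
by rewrite horner_sum mulr_sumr.
Qed.

Lemma quadratureZ m a p : quadrature m (a *: p) = a * quadrature m p.
Proof. by rewrite /quadrature mulr_sumr; apply: eq_bigr => i _; rewrite hornerZ mulrCA. Qed.

Section NonnegPoly.
Variables (m : nat) (c : nat -> R).
Let p : {poly R} := \sum_(k < m) c k *: cheb R k.
Hypotheses (m_gt0 : (0 < m)%N) (p_ge0 : forall x, 0 <= p.[x]).

Lemma quadrature_coef M k : (k < m)%N -> (m + k <= 2 * M)%N ->
  quadrature M (p * cheb R k) = c k.
Proof.
move=> km mkM; rewrite /p mulr_suml quadrature_sum (bigD1 (Ordinal km)) //=.
rewrite big1 => [|i ik].
  by rewrite addr0 -scalerAl quadratureZ quadrature_cheb ?eqxx ?mulr1 //; lia.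
rewrite -scalerAl quadratureZ quadrature_cheb; last by have := ltn_ord i; lia.
by rewrite (negPf (_ : (i : nat) != k)) ?mulr0.
Qed.

Lemma quadrature_coef0 M : (m <= 2 * M)%N -> quadrature M p = c 0%N.
Proof. by move=> mM; rewrite -[p]mulr1 -cheb0 quadrature_coef ?addn0. Qed.

(** c_k is the quadrature of p U_k, and |U_k| <= k + 1 at the nodes of nonzero weight; nonnegativity
    of p and of the weights then leaves (k + 1) times the quadrature of p, which is c_0. *)
Lemma cheb_coef_le k : (k < m)%N -> `|c k| <= k.+1%:R * c 0%N.
Proof.
move=> km; rewrite -(quadrature_coef (M := m) km); last by lia.
rewrite -(quadrature_coef0 (M := m)); last by lia.
rewrite mulr_sumr (le_trans (ler_norm_sum _ _ _)) //; apply: ler_sum => i _.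
case: (posnP i) => [->|i0]; first by rewrite weight0 !mul0r mulr0 normr0.
rewrite hornerM normrM (ger0_norm (weight_ge0 _ _)) normrM (ger0_norm (p_ge0 _)).
rewrite [leLHS]mulrA [leLHS]mulrC.
apply: ler_wpM2r; first by rewrite mulr_ge0 // weight_ge0.
apply: cheb_le.
by rewrite gt_eqF // sin_node_gt0 // i0 -ltnS ltn_ord.
Qed.

End NonnegPoly.

End Quadrature.

(** * Comparison with the semicircle law *)

Section Trig.
Variable R : realType.
Implicit Types (a b h t : R).

Lemma sin_mvt h : 0 < h -> exists2 c : R, 0 < c < h & sin h = cos c * h.
Proof.
move=> h0; have [|c] := @MVT R sin cos 0 h h0 (fun x _ => is_derive_sin x).
  by apply: continuous_subspaceT; apply: continuous_sin.
by rewrite in_itv /= sin0 !subr0 => ch ->; exists c.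
Qed.

Lemma sin_abs_le h : `|sin h| <= `|h|.
Proof.
wlog h0 : h / 0 <= h => [hw|].
  case: (lerP 0 h) => [/hw //|h0].
  by have := hw (- h); rewrite sinN !normrN => -> //; lra.
move: h0; rewrite le_eqVlt => /orP[/eqP<-|h_gt0]; first by rewrite sin0.
have [c _ ->] := sin_mvt h_gt0.
by rewrite normrM (gtr0_norm h_gt0) ler_piMl ?cos_max // ltW.
Qed.

Lemma cos_lip a b : `|cos a - cos b| <= `|a - b|.
Proof.
pose u := (a + b) / 2; pose v := (a - b) / 2.
have : a = u + v by rewrite /u /v; field.
have : b = u - v by rewrite /u /v; field.
move: u v => u v -> ->.
rewrite cosB cosD.
have -> : cos u * cos v - sin u * sin v - (cos u * cos v + sin u * sin v) =
  - (2 * (sin u * sin v)) by ring.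
have -> : u + v - (u - v) = 2 * v by ring.
rewrite normrN !normrM ler_wpM2l // (le_trans _ (sin_abs_le v)) //.
by rewrite ler_piMl // sin_max.
Qed.

Lemma sub_sin_le h : 0 <= h -> `|h - sin h| <= h ^+ 2.
Proof.
rewrite le_eqVlt => /orP[/eqP<-|h_gt0]; first by rewrite sin0 subrr normr0 expr0n.
have [c /andP[c0 ch] ->] := sin_mvt h_gt0.
have -> : h - cos c * h = (cos 0 - cos c) * h by rewrite cos0; ring.
rewrite normrM (gtr0_norm h_gt0) expr2; apply: ler_wpM2r; first exact: ltW.
apply: le_trans (cos_lip _ _) _; rewrite sub0r normrN gtr0_norm //; exact: ltW.
Qed.

(* The semicircle mass of [[2 cos t, 2]]. *)
Definition sc_tail t : R := (t - sin t * cos t) / pi.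

Lemma sc_tail0 : sc_tail 0 = 0.
Proof. by rewrite /sc_tail sin0 mul0r subrr mul0r. Qed.

Lemma sc_tailpi : sc_tail pi = 1.
Proof. by rewrite /sc_tail sinpi mul0r subr0 divff // gt_eqF // pi_gt0. Qed.

(** In this form the mass is directly comparable with the weight at angle b, which is h (1 - cos 2b)
    / pi for the step h = b - a. *)
Lemma sc_tailB a b :
  sc_tail b - sc_tail a = ((b - a) - sin (b - a) * cos (a + b)) / pi.
Proof.
rewrite /sc_tail -mulrBl; congr (_ / _); rewrite sinB cosD.
have -> : (sin b * cos a - cos b * sin a) * (cos a * cos b - sin a * sin b) =
  sin b * cos b * (cos a ^+ 2 + sin a ^+ 2) - sin a * cos a * (cos b ^+ 2 + sin b ^+ 2).
  by ring.
by rewrite !cos2Dsin2; ring.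
Qed.

Lemma sc_tail_incr a b : a <= b -> 0 <= sc_tail b - sc_tail a <= 2 * (b - a) / pi.
Proof.
move=> ab; have d0 : 0 <= b - a by rewrite subr_ge0.
have : `|sin (b - a) * cos (a + b)| <= b - a.
  rewrite normrM -[leRHS](ger0_norm d0) (le_trans _ (sin_abs_le _)) //.
  by rewrite ler_piMr // cos_max.
rewrite ler_norml => /andP[h1 h2]; rewrite sc_tailB.
rewrite divr_ge0 ?pi_ge0 ?subr_ge0 //= ler_wpM2r ?invr_ge0 ?pi_ge0 //.
lra.
Qed.

Lemma pi_le4 : pi <= 4 :> R.
Proof. by have := @pihalf_lt2 R; lra. Qed.

End Trig.

Section Counting.
Variables (R : realType) (n m : nat) (lam : 'I_n -> R).
Hypothesis m_gt0 : (0 < m)%N.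

Definition cum_weight j : R := \sum_(i < j.+1) weight R m i.

Lemma cum_weight_m : cum_weight m = 1.
Proof.
have E : quadrature m (cheb R 0 * cheb R 0) = 1 by rewrite quadrature_cheb //; lia.
by rewrite -[RHS]E cheb0 mulr1; apply: eq_bigr => i _; rewrite hornerC mulr1.
Qed.

Lemma cum_weight_pred j : (0 < j <= m)%N ->
  cum_weight j.-1 = \sum_(i < m.+1 | (i < j)%N) weight R m i.
Proof.
case/andP=> j0 jm; rewrite /cum_weight prednK //.
by rewrite (big_ord_widen m.+1 (fun i => weight R m i)) // ltnW.
Qed.

Lemma node_angleS i : node_angle R m i.+1 = node_angle R m i + pi / m.+1%:R.
Proof. by rewrite /node_angle -natr1 mulrDl mul1r mulrDl. Qed.

(** Each weight differs from the semicircle mass between adjacent angles by at most 2h^2/pi, with h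
    = pi/(m+1); m + 1 steps add up to 2pi/(m+1) <= 8/(m+1). *)
Lemma cum_weight_sc j : (j <= m.+1)%N ->
  `|cum_weight j - sc_tail (node_angle R m j)| <= 8 / m.+1%:R.
Proof.
pose h : R := pi / m.+1%:R.
have h0 : 0 <= h by rewrite divr_ge0 ?pi_ge0.
have pi0 : 0 < pi :> R := pi_gt0 R.
have mne : m.+1%:R != 0 :> R by rewrite pnatr_eq0.
move=> jm; apply: (@le_trans _ _ (j%:R * (2 * h ^+ 2 / pi))); last first.
  apply: (@le_trans _ _ (m.+1%:R * (2 * h ^+ 2 / pi))).
    by rewrite ler_wpM2r ?ler_nat // divr_ge0 ?pi_ge0 // mulr_ge0 // sqr_ge0.
  have e (p M : R) : p != 0 -> M != 0 -> M * (2 * (p / M) ^+ 2 / p) = 2 * p / M.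
    by move=> p0 M0; field; rewrite M0 p0.
  rewrite /h e ?gt_eqF //.
  by rewrite ler_wpM2r ?invr_ge0 //; have := @pi_le4 R; lra.
elim: j jm => [|j IH] jm.
  by rewrite /cum_weight big_ord1 weight0 {1}/node_angle !mul0r sc_tail0 subrr normr0.
rewrite /cum_weight big_ord_recr /= -/(cum_weight j) -natr1 mulrDl mul1r.
set a := node_angle R m j; set b := node_angle R m j.+1.
have -> : cum_weight j + weight R m j.+1 - sc_tail b =
  (cum_weight j - sc_tail a) + (weight R m j.+1 - (sc_tail b - sc_tail a)) by ring.
rewrite (le_trans (ler_normD _ _)) // lerD // ?IH 1?ltnW // sc_tailB.
have bah : b - a = h by rewrite /b node_angleS -/a /h; ring.
rewrite bah.
have -> : weight R m j.+1 = h * (1 - cos (b + b)) / pi.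
  rewrite /weight -/b cosD -!expr2 cos2sin2 /h.
  have e (p M c : R) : p != 0 -> M != 0 -> 2 / M * c = p / M * (1 - (1 - c - c)) / p.
    by move=> p0 M0; field; rewrite M0 p0.
  by apply: e; rewrite ?gt_eqF.
have -> : h * (1 - cos (b + b)) / pi - (h - sin h * cos (a + b)) / pi =
  ((cos (a + b) - cos (b + b)) * h - (h - sin h) * cos (a + b)) / pi.
  by ring.
rewrite normrM (ger0_norm (_ : 0 <= pi^-1)) ?invr_ge0 ?pi_ge0 //.
rewrite ler_wpM2r ?invr_ge0 ?pi_ge0 // (le_trans (ler_normB _ _)) //.
have -> : 2 * h ^+ 2 = h * h + h ^+ 2 by ring.
clearbody h; rewrite !normrM (ger0_norm h0) lerD //.
  rewrite ler_wpM2r // (le_trans (cos_lip _ _)) //.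
  by rewrite (_ : a + b - (b + b) = - h) ?normrN ?ger0_norm // -bah; ring.
by rewrite (le_trans _ (sub_sin_le h0)) // ler_piMr // cos_max.
Qed.

Definition cheb_err : R :=
  \sum_(1 <= k < 2 * m) k.+1%:R * `|\sum_i (cheb R k).[lam i]|.

Lemma cheb_err_ge0 : 0 <= cheb_err.
Proof. by apply: sumr_ge0 => k _; apply: mulr_ge0. Qed.

(** The sum of q over the [lam i] majorizes the count; its constant Chebyshev coefficient gives the
    main term and the other coefficients give [cheb_err]. *)
Lemma count_le_node j : (0 < j <= m)%N ->
  (#|[pred i | lam i <= node R m j]|)%:R <= n%:R * (1 - cum_weight j.-1) + cheb_err.
Proof.
move=> j0m; have /andP[j0 jm] := j0m; pose y := node R m j.
pose L := [seq node R m i | i <- iota j.+1 (m - j)].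
pose U := [seq node R m i | i <- iota 1 j.-1].
have [||q [sq q0 q1 qL qU]] := @markov_stieltjes R L U y.
- by move=> _ /mapP[i + ->]; rewrite mem_iota => hi; rewrite /y ltr_node; lia.
- by move=> _ /mapP[i + ->]; rewrite mem_iota => hi; rewrite /y ltr_node; lia.
have {}sq : (size q <= 2 * m)%N.
  by apply: leq_trans sq _; rewrite !size_map !size_iota; lia.
have [c qE] := cheb_decomp sq.
have m2 : (0 < 2 * m)%N by lia.
have q0' x : 0 <= (\sum_(k < 2 * m) c k *: cheb R k).[x] by rewrite -qE.
(* By exactness of the quadrature, c_0 is the total weight of the nodes where q = 1. Nodes decrease
   with the index, so these are the indices i >= j. *)
have c0 : c 0%N = 1 - cum_weight j.-1.
  rewrite -(quadrature_coef0 c m2 (leqnn _)) -qE cum_weight_pred // -[1]cum_weight_m /cum_weight.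
  rewrite /quadrature [X in X - _](bigID (fun i : 'I_m.+1 => (i < j)%N)) /= addrAC subrr add0r.
  rewrite (bigID (fun i : 'I_m.+1 => (i < j)%N)) /= big1 ?add0r => [|i ij].
    apply: eq_bigr => i; rewrite -leqNgt => ji; rewrite qL ?mulr1 //.
    move: ji; rewrite leq_eqVlt inE => /orP[/eqP<-|ji]; first by rewrite eqxx.
    apply/orP; right; apply/mapP; exists (i : nat) => //; rewrite mem_iota.
    by have := ltn_ord i; lia.
  case: (posnP i) => [->|i0]; first by rewrite weight0 mul0r.
  rewrite qU ?mulr0 //; apply/mapP; exists (i : nat) => //; rewrite mem_iota; lia.
have c01 : 0 <= c 0%N <= 1.
  rewrite c0; apply/andP; split; last first.
    by rewrite gerBl sumr_ge0 // => i _; apply: weight_ge0.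
  rewrite subr_ge0 cum_weight_pred // -cum_weight_m /cum_weight.
  by rewrite big_mkcond; apply: ler_sum => i _; case: ifP => // _; apply: weight_ge0.
apply: (@le_trans _ _ (\sum_i q.[lam i])).
  rewrite -sum1_card natr_sum big_mkcond /=; apply: ler_sum => i _.
  by case: ifP => // /q1.
rewrite -c0 qE; under eq_bigr do rewrite horner_sum.
rewrite exchange_big /= -(prednK m2) big_ord_recl /= lerD //.
  rewrite le_eqVlt; apply/orP; left; apply/eqP.
  rewrite (eq_bigr (fun=> c 0%N)) => [|i _]; last by rewrite hornerZ cheb0 hornerC mulr1.
  by rewrite sumr_const card_ord mulr_natl.
rewrite /cheb_err -(prednK m2) big_add1 big_mkord; apply: ler_sum => k _.
rewrite /bump /= add1n; under eq_bigr do rewrite hornerZ.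
rewrite -mulr_sumr (le_trans (ler_norm _)) // normrM ler_wpM2r //.
have km : (k.+1 < 2 * m)%N by have := ltn_ord k; lia.
have := cheb_coef_le m2 q0' km; move/le_trans; apply.
by rewrite ler_piMr //; case/andP: c01.
Qed.

End Counting.

Section Kolmogorov.
Variables (R : realType) (n m : nat) (lam : 'I_n -> R).
Hypothesis m_gt0 : (0 < m)%N.

Let Fge y : R := (#|[pred i | y <= lam i]|)%:R.
Let Fgt y : R := (#|[pred i | y < lam i]|)%:R.
Let err := cheb_err m lam.
Let eps : R := n%:R * (12 / m.+1%:R) + err.

(** Reflection x -> -x preserves the weights and [cheb_err] and maps the node of index j to that of
    index m + 1 - j. *)
Lemma Fge_node j : (0 < j <= m)%N -> Fge (node R m j) <= n%:R * cum_weight R m j + err.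
Proof.
case/andP=> j0 jm; have := @count_le_node R n m (fun i => - lam i) m_gt0 (m.+1 - j).
have -> : cheb_err m (fun i => - lam i) = err.
  apply: eq_bigr => k _; congr (_ * _); under eq_bigr do rewrite cheb_opp.
  by rewrite -mulr_sumr normrM normrX normrN1 expr1n mul1r.
rewrite node_opp; last by lia.
have -> : Fge (node R m j) = #|[pred i | - lam i <= - node R m j]|%:R.
  by congr (_%:R); apply: eq_card => i; rewrite !inE lerN2.
move=> h; apply: le_trans (h _) _; first by lia.
rewrite lerD2r.
rewrite ler_wpM2l // lerBlDl -(cum_weight_m R m_gt0) /cum_weight.
rewrite -!(big_mkord predT (fun i => weight R m i)).
have -> : ((m.+1 - j).-1.+1 = (m - j).+1)%N by lia.
rewrite (big_cat_nat (n := (m - j).+1)) //=; last by lia.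
rewrite lerD2l -[(m - j).+1]add1n big_addn.
have -> : (m.+1 - (m - j) = j.+1)%N by lia.
rewrite big_nat_rev /= [leRHS]big_ltn // weight0 add0r; apply: ler_sum_nat => i ij.
rewrite le_eqVlt -(weight_opp R (i := i)); last by lia.
by apply/orP; left; apply/eqP; congr (weight _ _ _); lia.
Qed.

Lemma Fgt_node j : (0 < j <= m)%N -> n%:R * cum_weight R m j.-1 - err <= Fgt (node R m j).
Proof.
move=> jm; have := count_le_node lam m_gt0 jm; rewrite -/err.
have : Fgt (node R m j) + (#|[pred i | lam i <= node R m j]|)%:R = n%:R.
  rewrite -natrD; congr (_%:R); rewrite -[RHS]card_ord -(cardC [pred i | node R m j < lam i]).
  by congr (_ + _)%N; apply: eq_card => i; rewrite !inE leNgt.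
lra.
Qed.

Lemma Fge_le_n y : Fge y <= n%:R.
Proof. by rewrite ler_nat -[leqRHS]card_ord max_card. Qed.

Lemma Fge_decr y z : y <= z -> Fge z <= Fge y.
Proof.
move=> yz; rewrite ler_nat; apply: subset_leq_card; apply/fintype.subsetP => i.
by rewrite !inE; apply: le_trans.
Qed.

Lemma Fgt_decr y z : y <= z -> Fgt z <= Fgt y.
Proof.
move=> yz; rewrite ler_nat; apply: subset_leq_card; apply/fintype.subsetP => i.
by rewrite !inE; apply: le_lt_trans.
Qed.

(** The angle t is compared with a nearby node angle. The 12 in [eps] is 8 from [cum_weight_sc] plus
    4 from a displacement of at most 2h, [sc_tail] having Lipschitz constant 2/pi. *)
Lemma kolmogorov_cos t : 0 <= t <= pi ->
  Fge (2 * cos t) <= n%:R * sc_tail t + eps /\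
  n%:R * sc_tail t - eps <= Fgt (2 * cos t).
Proof.
case/andP => t0 tpi; set h : R := pi / m.+1%:R.
have pi0 : 0 < pi :> R := pi_gt0 R.
have h0 : 0 < h by rewrite divr_gt0.
have hpi : 2 * h / pi = 2 / m.+1%:R.
  have e (p M : R) : p != 0 -> M != 0 -> 2 * (p / M) / p = 2 / M.
    by move=> p0 M0; field; rewrite M0 p0.
  by rewrite e ?gt_eqF ?pnatr_eq0.
have mh : m%:R * h + h = pi.
  by rewrite -{2}[h]mul1r -mulrDl natr1 /h mulrC divfK ?pnatr_eq0.
have angE i : node_angle R m i = i%:R * h by rewrite /node_angle /h mulrA.
pose j := Num.truncn (t / h).
have [hj1 hj2] : j%:R * h <= t /\ t < j.+1%:R * h.
  have /andP[] := truncn_itv (divr_ge0 t0 (ltW h0)).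
  by rewrite ler_pdivlMr // ltr_pdivrMr.
have jm : (j <= m.+1)%N.
  rewrite -(ler_nat R) -(ler_pM2r h0) (le_trans hj1) // (le_trans tpi) //.
  by rewrite /h mulrC divfK ?pnatr_eq0.
clearbody j; clearbody h.
have err0 : 0 <= err := cheb_err_ge0 m lam.
have nn : 0 <= n%:R :> R by [].
have m0 : 0 <= m.+1%:R^-1 :> R by rewrite invr_ge0.
have le_eps a b : a <= b + 12 / m.+1%:R -> n%:R * a <= n%:R * b + eps.
  by move=> ab; rewrite /eps addrA -mulrDr ler_wpDr // ler_wpM2l.
have m412 : 4 / m.+1%:R <= 12 / m.+1%:R :> R by rewrite ler_wpM2r // ler_nat.
have inv2 a b : a <= b -> b - a <= 2 * h -> sc_tail b <= sc_tail a + 4 / m.+1%:R.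
  move=> ab b2h; have /andP[_] := sc_tail_incr ab; rewrite lerBlDl => /le_trans; apply.
  rewrite lerD2l (@le_trans _ _ (2 * (2 * h / pi))) //.
    by rewrite -mulrA ler_wpM2l // ler_wpM2r // invr_ge0 ltW.
  by rewrite hpi mulrA -natrM.
split.
  case: (ltnP j m) => [jm'|mj]; last first.
    apply: (le_trans (Fge_le_n _)).
    rewrite -[leLHS]mulr1; apply: le_eps.
    have := inv2 _ _ tpi; rewrite sc_tailpi => h1.
    apply: (@le_trans _ _ (sc_tail t + 4 / m.+1%:R)); last by rewrite lerD2l.
    apply: h1; have : m%:R * h <= j%:R * h by rewrite ler_wpM2r ?ler_nat // ltW.
    by rewrite -mh; move: hj1; move: (j%:R * h) (m%:R * h) => A B *; lra.
  have yx : node R m j.+1 <= 2 * cos t.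
    rewrite /node ler_pM2l // leNgt ltr_cos ?in_itv /= ?node_angle_itv ?t0 ?tpi //;
      last exact: ltnW.
    by rewrite angE -leNgt ltW.
  apply: (le_trans (Fge_decr yx)); apply: (le_trans (Fge_node _)); first by rewrite jm'.
  rewrite /eps addrA lerD2r -mulrDr ler_wpM2l //.
  have := @cum_weight_sc R m j.+1 (ltnW jm'); rewrite ler_norml angE => /andP[_ h1].
  have h2 : sc_tail (j.+1%:R * h) <= sc_tail t + 4 / m.+1%:R.
    apply: inv2; first exact: ltW.
    by move: hj1; rewrite -natr1 mulrDl mul1r; move: (j%:R * h) => A *; lra.
  move: h1 h2; have -> : 12 / m.+1%:R = 4 / m.+1%:R + 8 / m.+1%:R :> R by rewrite -mulrDl -natrD.
  by move: (4 / m.+1%:R : R) (8 / m.+1%:R : R) => A B *; lra.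
case: (posnP j) => [j0|j0].
  have : sc_tail t <= sc_tail 0 + 4 / m.+1%:R.
    by apply: inv2 => //; move: hj2; rewrite j0 mul1r; lra.
  rewrite sc_tail0 add0r => h1; apply: (@le_trans _ _ 0); last by [].
  rewrite lerBlDr; have := @le_eps (sc_tail t) 0; rewrite mulr0; apply.
  by rewrite add0r (le_trans h1).
(* The value j = m + 1 occurs at t = pi and is not the index of a quadrature node. *)
pose k := minn j m; have km : (0 < k <= m)%N by rewrite leq_min j0 m_gt0 geq_minr.
have km1 : (k <= m.+1)%N by case/andP: km => _ /leqW.
have kt : k%:R * h <= t.
  by apply: le_trans hj1; rewrite ler_wpM2r ?ler_nat ?geq_minl // ltW.
have yx : 2 * cos t <= node R m k.
  rewrite /node ler_pM2l // leNgt ltr_cos ?in_itv /= ?node_angle_itv ?t0 ?tpi //.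
  by rewrite angE -leNgt.
apply: (le_trans _ (Fgt_decr yx)); apply: (le_trans _ (Fgt_node km)).
have := @cum_weight_sc R m k.-1 (leq_trans (leq_pred k) km1); rewrite ler_norml angE => /andP[h1 _].
have h2 : sc_tail t <= sc_tail (k.-1%:R * h) + 4 / m.+1%:R.
  have k1 : k.-1%:R * h = k%:R * h - h.
    by rewrite -{2}(prednK (proj1 (andP km))) -natr1; ring.
  apply: inv2; first by move: kt; rewrite k1; move: (k%:R * h) => A *; lra.
  rewrite k1; case: (leqP j m) => jm'.
    move: hj2; rewrite /k (minn_idPl jm') -natr1 mulrDl mul1r.
    by move: (j%:R * h) => A *; lra.
  move: tpi; rewrite /k (minn_idPr (ltnW jm')) -mh.
  by move: (m%:R * h) => A *; lra.
have h3 : sc_tail t <= cum_weight R m k.-1 + 12 / m.+1%:R.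
  move: h1 h2; have -> : 12 / m.+1%:R = 4 / m.+1%:R + 8 / m.+1%:R :> R by rewrite -mulrDl -natrD.
  by move: (4 / m.+1%:R : R) (8 / m.+1%:R : R) => A B *; lra.
have := ler_wpM2l nn h3; rewrite mulrDr /eps.
by move: (n%:R * sc_tail t) (n%:R * (12 / _)) (n%:R * cum_weight _ _ _) => A B C *; lra.
Qed.

End Kolmogorov.

(** * Eigenvalues of real symmetric matrices *)

Section SymmetricSpectrum.

Lemma char_poly_conj (F : comNzRingType) n (P Q B : 'M[F]_n) :
  P *m Q = 1%:M -> char_poly (Q *m B *m P) = char_poly B.
Proof.
move=> PQ; pose f (A : 'M[F]_n) : 'M[{poly F}]_n := map_mx (@polyC F) A.
have fPQ : f P *m f Q = 1%:M by rewrite /f -map_mxM PQ map_mx1.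
have fQP : f Q *m f P = 1%:M := mulmx1C fPQ.
rewrite /char_poly /char_poly_mx !map_mxM -/(f _) -/(f _) -/(f _).
have -> : 'X%:M - f Q *m f B *m f P = f Q *m ('X%:M - f B) *m f P.
  by rewrite mulmxBr mulmxBl mul_mx_scalar -scalemxAl fQP scalemx1.
by rewrite !det_mulmx mulrC mulrA -det_mulmx fPQ det1 mul1r.
Qed.

Lemma char_poly_diag (F : comNzRingType) n (d : 'rV[F]_n) :
  char_poly (diag_mx d) = \prod_i ('X - (d 0 i)%:P).
Proof.
rewrite char_poly_trig; last by apply/is_trig_mxP => i j ij; rewrite mxE -val_eqE (ltn_eqF ij).
by apply: eq_bigr => i _; rewrite mxE eqxx.
Qed.

(** The matrix is diagonalized over R[i] as a Hermitian one; its diagonal is real, so both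
    identities descend through the injective embedding of R. *)
Lemma symmetric_spectrum (R : realType) n (M : 'M[R]_n) : M^T = M ->
  exists lam : 'I_n -> R, char_poly M = \prod_i ('X - (lam i)%:P) /\
    forall k, \tr (cheb_mx M k) = \sum_i (cheb R k).[lam i].
Proof.
move=> Msym; pose f : {rmorphism R -> R[i]} := real_complex R.
pose Mc := map_mx f M.
have hM : Mc \is hermsymmx.
  apply: realsym_hermsym.
    by apply/is_hermitianmxP; rewrite expr0 scale1r map_mx_id // /Mc map_trmx Msym.
  by apply/mxOverP => i j; rewrite mxE; apply/complex_realP; exists (M i j).
have /orthomx_spectralP := hermitian_normalmx hM.
have := hermitian_spectral_diag_real hM.
have := spectral_unit Mc.
move: (spectralmx Mc) (spectral_diag Mc) => P D Pu Dreal ME.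
have PQ : P *m invmx P = 1%:M by rewrite mulmxV.
have DE i : D 0 i = f (complex.Re (D 0 i)).
  by have /mxOverP/(_ 0 i)/complex_realP[x ->] := Dreal.
exists (fun i => complex.Re (D 0 i)); split.
  apply: (@map_inj_poly _ _ f); [exact: complexI | exact: rmorph0 |].
  rewrite map_char_poly -/Mc ME char_poly_conj // char_poly_diag rmorph_prod.
  by apply: eq_bigr => i _; rewrite /= map_polyXsubC -DE.
move=> k; apply: (@complexI R); rewrite -/(f _) -/(f _).
rewrite -trace_map_mx map_cheb_mx -/Mc ME cheb_mx_conj // -mulmxA mxtrace_mulC -mulmxA PQ mulmx1.
rewrite cheb_mx_diag mxtrace_diag rmorph_sum; apply: eq_bigr => i _.
by rewrite mxE {1}DE rmorph_cheb.
Qed.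

Lemma eig_count_spectrum (R : realType) n (M : 'M[R]_n) (lam : 'I_n -> R) (I : interval R) :
  char_poly M = \prod_i ('X - (lam i)%:P) ->
  eig_count M I = #|[pred i | lam i \in I]|.
Proof.
move=> ME; pose s := codom lam.
have mupE x : mup x (char_poly M) = count_mem x s.
  by rewrite ME -mu_prod_XsubC /s /codom /image_mem big_map big_enum.
rewrite /eig_count -(bigfs _ (r := undup s)) ?undup_uniq //; last first.
  by move=> x _; rewrite mem_undup mupE => /count_memPn.
transitivity (count [in I] s).
  rewrite -sum1_count -[RHS]big_undup_iterop_count; apply: eq_bigr => x _.
  by rewrite mupE Monoid.iteropE iter_addn_0 mul1n.
rewrite /s /codom /image_mem count_map -size_filter cardE /enum_mem -filter_predI.
by congr size; apply: eq_filter => i; rewrite !inE andbT.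
Qed.

End SymmetricSpectrum.

Local Open Scope classical_set_scope.
Local Open Scope ring_scope.

(** * Integrals of the semicircle density *)

Section Semicircle.
Variable R : realType.
Local Notation mu := (@lebesgue_measure R).
Implicit Types (a b t x : R).

Lemma f_scE x : f_sc x = (2 * pi)^-1 * Num.sqrt (4 - x ^+ 2).
Proof.
rewrite /f_sc; case: ifPn => // h; rewrite ler0_sqrtr ?mulr0 //.
have [h1|h1] := lerP x (-2); first by nra.
have h2 : 2 <= x by move: h; rewrite h1 /= -leNgt.
by nra.
Qed.

Lemma f_sc_cos t : 0 <= t <= pi -> f_sc (2 * cos t) = sin t / pi.
Proof.
move=> tpi; have s0 : 0 <= sin t by apply: sin_ge0_pi.
rewrite f_scE; have -> : 4 - (2 * cos t) ^+ 2 = (2 * sin t) ^+ 2.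
  by rewrite !exprMn cos2sin2; ring.
rewrite sqrtr_sqr ger0_norm ?mulr_ge0 // invfM.
have : pi != 0 :> R by rewrite gt_eqF ?pi_gt0.
by move: (@pi R) => p p0; field.
Qed.

Lemma continuous_f_sc : continuous (@f_sc R).
Proof.
have -> : @f_sc R = (fun x => (2 * pi)^-1 * Num.sqrt (4 - x ^+ 2)).
  by apply/funext => x; rewrite f_scE.
move=> x; apply: cvgM; first exact: cvg_cst.
apply: (cvg_comp (fun x : R => 4 - x ^+ 2) Num.sqrt); last exact: sqrt_continuous.
by apply: cvgB; [exact: cvg_cst | exact: exprn_continuous].
Qed.

Lemma measurable_f_sc (A : set R) : measurable_fun A (fun x : R => (f_sc x)%:E).
Proof.
apply/measurable_EFinP; apply: measurable_funTS; apply: continuous_measurable_fun.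
exact: continuous_f_sc.
Qed.

Lemma is_derive_sc_tail t : is_derive t 1 (@sc_tail R) (2 * sin t ^+ 2 / pi).
Proof.
have -> : @sc_tail R = pi^-1 *: ((@id R) - sin * cos).
  by apply/funext => x; rewrite /sc_tail mulrC.
apply: is_derive_eq.
rewrite [LHS](_ : _ = pi^-1 * (1 - (sin t * - sin t + cos t * cos t))) //.
rewrite mulrN -!expr2 cos2sin2; move: (@pi R) => p; ring.
Qed.

Lemma is_derive_2cos t : is_derive t 1 (fun t : R => 2 * cos t) (- (2 * sin t)).
Proof.
have -> : (fun t : R => 2 * cos t) = 2 *: (@cos R) by [].
by apply: is_derive_eq; rewrite scalerN.
Qed.

(** The decreasing substitution x = 2 cos t turns the integrand into 2 sin(t)^2 / pi, the derivative
    of [sc_tail]. *)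
Lemma integral_f_sc_cos a b : 0 <= a -> a <= b -> b <= pi ->
  (\int[mu]_(x in `[(2 * cos b)%R, (2 * cos a)%R]) (f_sc x)%:E = (sc_tail b - sc_tail a)%:E)%E.
Proof.
move=> a0; rewrite le_eqVlt => /predU1P[<- _|ab bpi].
  by rewrite set_itv1 integral_set1 subrr.
pose F (t : R) : R := 2 * cos t.
have F' : derive1 F = (fun t => - (2 * sin t)).
  by apply/funext => t; rewrite derive1E; have [_ ->] := is_derive_2cos t.
have cF' : continuous (derive1 F).
  rewrite F' => t; apply: cvgN; apply: cvgM; [exact: cvg_cst | exact: continuous_sin].
have dF t : derivable F t 1 by have [] := is_derive_2cos t.
have cF : continuous F.
  by move=> t; apply: differentiable_continuous; apply/derivable1_diffP.
rewrite (@integration_by_substitution_decreasing R F (@f_sc R) a b (ltW ab)).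
- pose g (t : R) : R := 2 * sin t ^+ 2 / pi.
  have cg : continuous g.
    move=> t; apply: cvgM; last exact: cvg_cst.
    apply: cvgM; first exact: cvg_cst.
    apply: (cvg_comp (@sin R) (fun x : R => x ^+ 2)); first exact: continuous_sin.
    exact: exprn_continuous.
  rewrite (_ : \int[mu]_(x in _) _ = \int[mu]_(x in `[a, b]) (g x)%:E)%E; last first.
    apply: eq_integral => t; rewrite inE /= in_itv /= => /andP[at_ tb].
    change ((f_sc (F t) * - (derive1 F t))%:E = (g t)%:E).
    rewrite F' /F f_sc_cos; last by rewrite (le_trans a0 at_) (le_trans tb bpi).
    by congr EFin; rewrite /g opprK; move: (@pi R) => p; ring.
  rewrite (continuous_FTC2 (F := @sc_tail R) ab) //.
  + by apply: continuous_subspaceT.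
  + have ct : continuous (@sc_tail R).
      move=> t; apply: differentiable_continuous; apply/derivable1_diffP.
      by have [] := is_derive_sc_tail t.
    split; first by move=> t _; have [] := is_derive_sc_tail t.
      exact/cvg_at_right_filter/ct.
    exact/cvg_at_left_filter/ct.
  + by move=> t _; rewrite derive1E; have [_ ->] := is_derive_sc_tail t.
- move=> x y; rewrite !in_itv /= => /andP[ax xb] /andP[ay yb] xy.
  by rewrite ltr_pM2l // ltr_cos // in_itv /=; apply/andP; split; lra.
- by move=> t _; exact: cF'.
- by apply/cvg_ex; eexists; apply: cvg_at_right_filter; exact: cF'.
- by apply/cvg_ex; eexists; apply: cvg_at_left_filter; exact: cF'.
- split; first by move=> t _.
    exact/cvg_at_right_filter/cF.
  exact/cvg_at_left_filter/cF.
- by apply: continuous_subspaceT; exact: continuous_f_sc.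
Qed.

(* The angle t with 2 cos t = y, after projecting y to [[-2, 2]]. *)
Definition sc_angle (y : R) : R := acos (Num.max (-1) (Num.min 1 (y / 2))).

Lemma sc_angle_itv y : 0 <= sc_angle y <= pi.
Proof.
have h : (-1 : R) <= Num.max (-1) (Num.min 1 (y / 2)) <= 1.
  by rewrite le_max lexx ge_max ge_min lexx /= andbT; lra.
by rewrite acos_ge0 // acos_lepi.
Qed.

Lemma cos_sc_angle y : 2 * cos (sc_angle y) = Num.max (-2) (Num.min 2 y).
Proof.
rewrite /sc_angle acosK; last first.
  by rewrite in_itv /= le_max lexx ge_max ge_min lexx /= andbT; lra.
rewrite maxr_pMr // minr_pMr // mulrN1 mulr1; congr (Num.max _ (Num.min _ _)).
by field.
Qed.

Lemma integral_f_sc a b : a <= b ->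
  (\int[mu]_(x in `[a, b]) (f_sc x)%:E =
   (sc_tail (sc_angle a) - sc_tail (sc_angle b))%:E)%E.
Proof.
move=> ab.
have -> : (\int[mu]_(x in `[a, b]) (f_sc x)%:E =
   \int[mu]_(x in `[a, b] `&` `[(-2)%R, 2%R]) (f_sc x)%:E)%E.
  rewrite integral_mkcondr; apply: eq_integral => x _; rewrite patchE.
  case: ifPn => //; rewrite notin_setE /= in_itv /= => /negP; rewrite negb_and -!ltNge => h.
  rewrite /f_sc ifF //; apply/negbTE; rewrite negb_and -!leNgt.
  by case/orP: h => /ltW ->; rewrite ?orbT.
have [a2|a2] := ltP 2 a.
  have -> : `[a, b] `&` `[-2, 2] = set0 :> set R.
    by rewrite -subset0 => x /=; rewrite !in_itv /= => -[/andP[ax _] /andP[_ x2]]; lra.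
  rewrite integral_set0 /sc_angle !(min_idPl _) ?subrr //; lra.
have [b2|b2] := ltP b (-2).
  have -> : `[a, b] `&` `[-2, 2] = set0 :> set R.
    by rewrite -subset0 => x /=; rewrite !in_itv /= => -[/andP[ax xb] /andP[x2 _]]; lra.
  rewrite integral_set0 /sc_angle.
  rewrite ![Num.max _ (Num.min _ _)](max_idPl _) ?subrr //; rewrite ge_min; lra.
have ca : 2 * cos (sc_angle a) = Num.max (-2) a by rewrite cos_sc_angle (min_idPr a2).
have cb : 2 * cos (sc_angle b) = Num.min 2 b.
  by rewrite cos_sc_angle; apply/max_idPr; rewrite le_min b2 andbT; lra.
have -> : `[a, b] `&` `[-2, 2] = [set` `[2 * cos (sc_angle a), 2 * cos (sc_angle b)]] :> set R.
  rewrite ca cb; apply/seteqP; split => x /=; rewrite !in_itv /= ge_max le_min.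
    by case=> /andP[-> ->] /andP[-> ->].
  by case/andP => /andP[-> ->] /andP[-> ->].
have /andP[ta1 ta2] := sc_angle_itv a; have /andP[tb1 tb2] := sc_angle_itv b.
apply: integral_f_sc_cos => //.
rewrite leNgt -ltr_cos ?in_itv /= ?ta1 ?tb1 // -leNgt -(@ler_pM2l _ 2) // ca cb.
by rewrite ge_max !le_min ab a2 b2 !andbT; lra.
Qed.

End Semicircle.

Section IntervalCount.
Variables (R : realType) (n m : nat) (lam : 'I_n -> R).
Hypothesis m_gt0 : (0 < m)%N.
Let eps : R := n%:R * (12 / m.+1%:R) + cheb_err m lam.
Let tail (y : R) : R := sc_tail (sc_angle y).

(** Outside [-2, 2] the projected angle is 0 or pi, and the trivial bounds 0 and n on the counts
    suffice. *)
Lemma kolmogorov y :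
  (#|[pred i | y <= lam i]|)%:R <= n%:R * tail y + eps /\
  n%:R * tail y - eps <= (#|[pred i | y < lam i]|)%:R.
Proof.
have [h1 h2] := kolmogorov_cos lam m_gt0 (sc_angle_itv y).
have eps0 : 0 <= eps by rewrite addr_ge0 ?cheb_err_ge0 // mulr_ge0 // divr_ge0.
rewrite cos_sc_angle in h1 h2; split.
  have [y2|y2] := lerP (-2) y.
    by apply: le_trans h1; apply: Fge_decr; rewrite ge_max y2 ge_min lexx orbT.
  apply: (le_trans (Fge_le_n lam y)); rewrite /tail /sc_angle.
  rewrite (max_idPl _); last by rewrite ge_min; apply/orP; right; lra.
  by rewrite acosN1 sc_tailpi mulr1 lerDl.
have [y2|y2] := lerP y 2.
  by apply: (le_trans h2); apply: Fgt_decr; rewrite le_max le_min y2 lexx orbT.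
rewrite /tail /sc_angle (min_idPl _); last by lra.
rewrite (max_idPr _); last by lra.
by rewrite acos1 sc_tail0 mulr0 add0r (@le_trans _ _ 0) // oppr_le0.
Qed.

Lemma card_pred_sum (P : pred 'I_n) : #|P| = (\sum_i P i)%N.
Proof. by rewrite -sum1_card big_mkcond; apply: eq_bigr => i _; rewrite unfold_in; case: (P i). Qed.

(** Whatever the endpoints, the count lies between a difference of half-line counts with [a] open
    and [b] closed and one with [a] closed and [b] open; each half-line costs one [eps]. *)
Lemma interval_count (ba bb : bool) a b : a < b ->
  `|(#|[pred i | lam i \in Interval (BSide ba a) (BSide bb b)]|)%:R
     - n%:R * (tail a - tail b)| <= 2 * eps.
Proof.
move=> ab; have [ha1 ha2] := kolmogorov a; have [hb1 hb2] := kolmogorov b.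
have memI x : x \in Interval (BSide ba a) (BSide bb b) -> a <= x <= b.
  by rewrite in_itv /=; case: (ba); case: (bb) => /=; lra.
have memI' x : a < x -> x < b -> x \in Interval (BSide ba a) (BSide bb b).
  by rewrite in_itv /=; case: (ba); case: (bb) => /= h1 h2; rewrite ?h1 ?h2 ?ltW.
move: (Interval _ _) memI memI' => I memI memI'.
have u1 : (#|[pred i | lam i \in I]| + #|[pred i | (b < lam i)%R]| <=
    #|[pred i | (a <= lam i)%R]|)%N.
  rewrite !card_pred_sum -big_split /=; apply: leq_sum => i _.
  case: (boolP (lam i \in I)) => [/memI/andP[-> lb]|_]; first by rewrite ltNge lb.
  by case: (ltP b) => // bl; rewrite (ltW (lt_trans ab bl)).
have u2 : (#|[pred i | (a < lam i)%R]| <=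
    #|[pred i | lam i \in I]| + #|[pred i | (b <= lam i)%R]|)%N.
  rewrite !card_pred_sum -big_split /=; apply: leq_sum => i _.
  case: (ltP a) => // al; case: (leP b) => bl; first by rewrite addn1.
  by rewrite memI'.
move: u1 u2; rewrite -!(ler_nat R) !natrD mulrBr.
move: ha1 ha2 hb1 hb2; move: (n%:R * tail a) (n%:R * tail b) => A B.
by rewrite ler_norml => *; apply/andP; split; lra.
Qed.

End IntervalCount.

(** * Deterministic bound in terms of short closed walks *)

Section Deterministic.
Variables (R : realType) (n d m : nat) (G : {set {set 'I_n}}).
Hypothesis rG : G \in regular_graphs n d.
Hypothesis m_gt0 : (0 < m)%N.
Hypothesis d_ge : (17 <= d)%N.

Definition short_walks : nat := (\sum_(1 <= j < 2 * m) closed_count j G)%N.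

Lemma adjacency_sym : (adjacency R G)^T = adjacency R G.
Proof. by apply/matrixP => i j; rewrite !mxE finset.setUC. Qed.

Lemma leq_3exp2 k : (k.+3 <= 3 * 2 ^ k)%N.
Proof. by elim: k => // k IH; rewrite expnS; lia. Qed.

(** Writing k = j + 2, the inequalities k + 1 <= 3 2^j and s >= 4 bound the term by (3/s^2) 2^(-j),
    a geometric series. *)
Lemma even_sum_le (s : R) K : 4 <= s ->
  \sum_(1 <= k < K) k.+1%:R * (s ^- k * (if odd k then 0 else 1)) <= 6 / s ^+ 2.
Proof.
move=> s4; have s0 : 0 < s by lra.
have s2 : 0 < s ^- 2 by rewrite invr_gt0 exprn_gt0.
have main j : \sum_(2 <= k < j.+2) k.+1%:R * (s ^- k * (if odd k then 0 else 1)) <=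
    6 / s ^+ 2 * (1 - 2 ^- j).
  elim: j => [|j IH]; first by rewrite big_geq // expr0 invr1 subrr mulr0.
  rewrite big_nat_recr //=; apply: le_trans (lerD IH (_ : _ <= 3 / s ^+ 2 * 2 ^- j)) _.
    apply: (@le_trans _ _ (j.+3%:R * s ^- j.+2)).
      rewrite ler_wpM2l //; case: ifP => _; rewrite ?mulr0 ?mulr1 // invr_ge0 exprn_ge0 //.
      exact: ltW.
    apply: (@le_trans _ _ ((3 * 2 ^+ j) * s ^- j.+2)).
      rewrite ler_wpM2r ?invr_ge0 ?exprn_ge0 ?(ltW s0) // -natrX -natrM ler_nat.
      exact: leq_3exp2.
    have h : 2 ^+ j * s ^- j <= 2 ^- j.
      rewrite -!exprVn -exprMn lerXn2r ?nnegrE ?mulr_ge0 ?invr_ge0 ?(ltW s0) //.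
      by rewrite ler_pdivrMr //; lra.
    have -> : s ^- j.+2 = s ^- 2 * s ^- j by rewrite -invfM -exprD.
    rewrite (_ : _ * _ = 3 / s ^+ 2 * (2 ^+ j * s ^- j)); last by ring.
    by rewrite ler_wpM2l // mulr_ge0 // ltW.
  rewrite [2 ^+ j.+1]exprS [(2 * _)^-1]invfM; move: (2 ^- j) (s ^- 2) => x y.
  by rewrite le_eqVlt; apply/orP; left; apply/eqP; field.
case: (leqP K 1) => [K1|]; first by rewrite big_geq // mulr_ge0 // ltW.
case: K => [|[|K]] // _.
by rewrite big_ltn //= !mulr0 add0r (le_trans (main K)) // ler_piMr ?mulr_ge0 ?(ltW s2) //.
Qed.

(** The trivial walks give the first term, s >= 4 coming from d >= 17. For the others s^(-k) <= 1,
    and fewer than 2m values of k, each with k + 1 <= 2m, give (2m)^2. *)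
Lemma cheb_err_adjacency (s : R) (lam : 'I_n -> R) : 0 < s -> s ^+ 2 = d%:R - 1 ->
  (forall k, \tr (cheb_mx (s^-1 *: adjacency R G) k) = \sum_i (cheb R k).[lam i]) ->
  cheb_err m lam <= n%:R * (6 / (d%:R - 1)) + ((2 * m) ^ 2 * short_walks)%:R.
Proof.
move=> s0 s2 trE.
have s4 : 4 <= s.
  rewrite -(@ler_pXn2r _ 2) ?nnegrE ?(ltW s0) // s2.
  have : 17%:R <= d%:R :> R by rewrite ler_nat.
  lra.
pose X : R := short_walks%:R.
have X0 : 0 <= X by [].
apply: (@le_trans _ _ (\sum_(1 <= k < 2 * m)
    (n%:R * (k.+1%:R * (s ^- k * (if odd k then 0 else 1))) + (2 * m)%:R * X))).
  rewrite /cheb_err; apply: ler_sum_nat => k /andP[k1 km].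
  rewrite -trE; have := tr_cheb_mx rG k s0 s2.
  move/(ler_wpM2l (ler0n R k.+1))/le_trans; apply; rewrite mulrDr mulrDr; apply: lerD.
    by rewrite le_eqVlt; apply/orP; left; apply/eqP; case: ifP => _; ring.
  apply: ler_pM => //; first by rewrite mulr_ge0 ?invr_ge0 ?exprn_ge0 ?(ltW s0) ?sumr_ge0.
    by rewrite ler_nat.
  apply: (@le_trans _ _ (1 * X)); last by rewrite mul1r.
  apply: ler_pM; rewrite ?invr_ge0 ?exprn_ge0 ?(ltW s0) ?sumr_ge0 //.
    by rewrite invf_le1 ?exprn_gt0 // exprn_ege1 //; lra.
  rewrite /X /short_walks natr_sum (big_cat_nat (n := k.+1) (leqW k1) km) /=.
  by rewrite lerDl sumr_ge0.
rewrite big_split /= -mulr_sumr; apply: lerD.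
  by rewrite ler_wpM2l // -s2 even_sum_le.
rewrite sumr_const_nat -[leLHS]mulr_natl /X -!natrM ler_nat -mulnn -[leqRHS]mulnA.
by rewrite leq_mul2r leq_subr orbT.
Qed.

Lemma N_interval_bound (ba bb : bool) (a b : R) : a < b ->
  `|(N_ d G (Interval (BSide ba a) (BSide bb b)))%:R -
    n%:R * (sc_tail (sc_angle a) - sc_tail (sc_angle b))| <=
  n%:R * (24 / m.+1%:R + 12 / (d%:R - 1)) + (8 * m ^ 2 * short_walks)%:R.
Proof.
move=> ab; pose s : R := Num.sqrt (d%:R - 1).
have d17 : 17%:R <= d%:R :> R by rewrite ler_nat.
have s2 : s ^+ 2 = d%:R - 1 by rewrite sqr_sqrtr //; lra.
have s0 : 0 < s by rewrite sqrtr_gt0; lra.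
have [lam [cE trE]] : exists lam : 'I_n -> R,
   char_poly (s^-1 *: adjacency R G) = \prod_i ('X - (lam i)%:P) /\
    forall k, \tr (cheb_mx (s^-1 *: adjacency R G) k) = \sum_i (cheb R k).[lam i].
  by apply: symmetric_spectrum; rewrite linearZ /= adjacency_sym.
rewrite /N_ (eig_count_spectrum _ cE).
apply: (le_trans (interval_count lam m_gt0 ba bb ab)).
have := cheb_err_adjacency s0 s2 trE.
have -> : (8 * m ^ 2 * short_walks)%:R = 2 * ((2 * m) ^ 2 * short_walks)%:R :> R.
  by rewrite -natrM; congr (_%:R); rewrite expnMn; lia.
have -> : n%:R * (24 / m.+1%:R + 12 / (d%:R - 1)) =
   2 * (n%:R * (12 / m.+1%:R) + n%:R * (6 / (d%:R - 1))) :> R by ring.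
by rewrite -mulrDr ler_pM2l // -addrA lerD2l.
Qed.

End Deterministic.

(** * Random regular graphs *)

Section Probability.
Variables (R : realType) (n d m : nat).
Hypotheses (m_gt0 : (0 < m)%N) (d_gt0 : (0 < d)%N) (d_le : (2 * d <= n)%N).
Hypothesis nd_ge : (2 * (8 * m + 2 * d ^ 2 + 2 * d) <= n * d)%N.

Let Om := regular_graphs n d.
Let B := (8 * m ^ 2 * (4 * m).+1 * (8 * m * d) ^ (4 * m))%N.

(** Cauchy-Schwarz up to a factor 2, from a_i a_j <= a_i^2 + a_j^2. *)
Lemma sqr_sum_le (N : nat) (a : nat -> nat) :
  ((\sum_(1 <= j < N) a j) ^ 2 <= 2 * N * \sum_(1 <= j < N) a j ^ 2)%N.
Proof.
rewrite -mulnn big_distrlr /=.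
apply: (@leq_trans (\sum_(1 <= i < N) \sum_(1 <= j < N) (a i ^ 2 + a j ^ 2))).
  by apply: leq_sum => i _; apply: leq_sum => j _; rewrite -!mulnn; nia.
under eq_bigr do rewrite big_split /= sum_nat_const_nat.
rewrite big_split /= sum_nat_const_nat -big_distrr /=.
move: (\sum_(1 <= j < N) _)%N => S; rewrite -mulnDl leq_mul2r; apply/orP; right; lia.
Qed.

Lemma short_walks_moment2 :
  (\sum_(G in Om) short_walks m G ^ 2 <= B * #|Om|)%N.
Proof.
apply: (@leq_trans (\sum_(G in Om) 2 * (2 * m) * \sum_(1 <= j < 2 * m) closed_count j G ^ 2)).
  by apply: leq_sum => G _; apply: sqr_sum_le.
rewrite -big_distrr /= exchange_big /=.
apply: (@leq_trans (2 * (2 * m) * \sum_(1 <= j < 2 * m)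
   ((4 * m).+1 * (8 * m * d) ^ (4 * m) * #|Om|))).
  rewrite leq_mul2l; apply/orP; right; rewrite big_nat [leqRHS]big_nat.
  apply: leq_sum => j /andP[j1 jm].
  apply: (leq_trans (closed_count_moment2 d_gt0 j1 d_le _)).
    by apply: leq_trans nd_ge; lia.
  rewrite leq_mul2r; apply/orP; right; apply: leq_mul; first by lia.
  have h : (4 * j.+1 * d <= 8 * m * d)%N by rewrite leq_mul2r; apply/orP; right; lia.
  apply: (@leq_trans ((8 * m * d) ^ (2 * j.+1))); first by rewrite leq_exp2r.
  by rewrite leq_pexp2l ?muln_gt0 ?m_gt0 ?d_gt0 //; lia.
rewrite sum_nat_const_nat /B; move: ((8 * m * d) ^ _)%N (#|Om|) => x o.
have -> : (8 * m ^ 2 * (4 * m).+1 * x * o = 8 * m ^ 2 * ((4 * m).+1 * x * o))%N.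
  by rewrite !mulnA.
rewrite mulnA leq_mul2r; apply/orP; right; rewrite -mulnn.
have -> : (8 * (m * m) = 2 * (2 * m) * (2 * m))%N by ring.
by rewrite leq_mul2l leq_subr orbT.
Qed.

(** Markov's inequality for the squared walk count: a graph violating [E] has more than tau short
    walks. *)
Lemma Prob_G_ge (E : pred {set {set 'I_n}}) (tau : R) : 0 < tau -> (0 < #|Om|)%N ->
  (forall G, G \in Om -> (short_walks m G)%:R <= tau -> E G) ->
  1 - B%:R / tau ^+ 2 <= Prob_G R d E.
Proof.
move=> tau0 Om0 hE; have o0 : 0 < #|Om|%:R :> R by rewrite ltr0n.
rewrite /Prob_G -/Om ler_pdivlMr // mulrBl mul1r lerBlDr -lerBlDl.
set EG := [set G in Om | E G]%SET; set bad := [set G in Om | ~~ E G]%SET.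
have -> : #|Om|%:R - #|EG|%:R = #|bad|%:R :> R.
  rewrite -natrB; last first.
    by apply: subset_leq_card; apply/fintype.subsetP => G; rewrite inE => /andP[].
  congr (_%:R); rewrite -(cardsID [set G | E G]%SET Om).
  have -> : #|Om :&: [set G | E G]|%SET = #|EG| by apply: eq_card => G; rewrite !inE.
  by rewrite addKn; apply: eq_card => G; rewrite !inE andbC.
rewrite mulrAC ler_pdivlMr ?exprn_gt0 // -natrM.
apply: (@le_trans _ _ (\sum_(G in Om) short_walks m G ^ 2)%N%:R); last first.
  by rewrite ler_nat short_walks_moment2.
rewrite mulr_natl -sumr_const natr_sum.
rewrite big_mkcond [leRHS]big_mkcond /=; apply: ler_sum => G _.
rewrite inE; case: (boolP (G \in Om)) => //= GOm; case: ifP => // nE.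
rewrite natrX lerXn2r ?nnegrE // ?(ltW tau0) // ltW // ltNge.
by apply: contra nE; apply: hE.
Qed.

End Probability.

(** * Choice of the truncation m *)

Section ParameterChoice.
Variable R : realType.
Implicit Types (alpha beta gamma delta : R) (n d m : nat).

Lemma ln_le_powR (x e : R) : 0 < x -> 0 < e -> ln x <= x `^ e / e.
Proof.
move=> x0 e0; rewrite ler_pdivlMr // mulrC -ln_powR.
have h : 0 < x `^ e by rewrite powR_gt0.
have := expR_ge1Dx (ln (x `^ e)); rewrite lnK ?posrE //.
by apply: le_trans; rewrite lerDr.
Qed.

Lemma near_powR_ln (c M : R) : 0 < c -> \forall n \near \oo, M <= ln (n%:R : R) `^ c.
Proof.
move=> c0; pose M1 := Num.max M 1; pose r := M1 `^ c^-1.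
have M1ge : 0 <= M1 by rewrite le_max ler01 orbT.
have r0 : 0 <= r by apply: powR_ge0.
near=> n; have : expR r <= n%:R by near: n; exact: nbhs_infty_ger.
move=> hn; have n0 : 0 < n%:R :> R := lt_le_trans (expR_gt0 r) hn.
have : r <= ln n%:R by rewrite -(expRK r) ler_ln ?posrE ?expR_gt0.
move=> rL; apply: (@le_trans _ _ M1); first by rewrite le_max lexx.
have {1}-> : M1 = r `^ c by rewrite /r -powRrM mulVf ?gt_eqF // powRr1.
apply: ge0_ler_powR; rewrite ?nnegrE //; first exact: ltW.
exact: le_trans rL.
Unshelve. all: by end_near. Qed.

Lemma walk_bound_powR n d m : (0 < m)%N -> (0 < d)%N -> (0 < n)%N ->
  (7 * m)%:R * ln ((8 * m * d)%:R : R) <= ln n%:R / 4 ->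
  ((8 * m * d) ^ (7 * m))%:R <= n%:R `^ (4^-1) :> R.
Proof.
move=> m0 d0 n0 h; have q0 : 0 < (8 * m * d)%:R :> R by rewrite ltr0n !muln_gt0 m0 d0.
rewrite natrX -[X in X ^+ _]lnK ?posrE // -expRM_natl /powR pnatr_eq0 gtn_eqF //.
by rewrite ler_expR [leRHS]mulrC.
Qed.

(** All polynomial factors fit into one cube; together with (8md)^(4m) the exponent is 3 + 4m <= 7m,
    whence the 7m used throughout. *)
Lemma cube_bounds m d : (0 < m)%N -> (0 < d)%N ->
  [/\ 2 * d <= (8 * m * d) ^ 3, 2 * (8 * m + 2 * d ^ 2 + 2 * d) <= (8 * m * d) ^ 3 &
    8 * m ^ 2 * (4 * m).+1 <= (8 * m * d) ^ 3]%N.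
Proof.
move=> m0 d0; have -> : ((8 * m * d) ^ 3 = 512 * ((m * m * m) * (d * d * d)))%N by ring.
have d3 : (d * d <= d * d * d)%N by rewrite leq_pmulr.
have m3 : (m <= m * m * m)%N by rewrite -mulnA leq_pmulr // muln_gt0 m0.
have d1 : (d <= d * d)%N by rewrite leq_pmulr.
have P1 : (m * m * m <= (m * m * m) * (d * d * d))%N by rewrite leq_pmulr // !muln_gt0 d0.
have P2 : (d * d * d <= (m * m * m) * (d * d * d))%N by rewrite leq_pmull // !muln_gt0 m0.
have h : (8 * m ^ 2 * (4 * m).+1 <= 40 * (m * m * m))%N.
  have -> : (40 * (m * m * m) = 8 * m ^ 2 * (5 * m))%N by ring.
  by rewrite leq_mul2l; apply/orP; right; lia.
rewrite -[in X in [/\ _, X & _]]mulnn.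
move: ((m * m * m) * (d * d * d))%N h m3 d3 d1 P1 P2 => P.
move: (m * m * m)%N (d * d * d)%N (d * d)%N (8 * m ^ 2 * (4 * m).+1)%N => *.
by split; lia.
Qed.

(** Each of the three error terms is kept below a third of delta d^(-alpha), so 72 is three times
    24. The tail exponent is 1/4 - 2 (3/4) = -5/4. *)
Lemma parameters_ok n d m alpha delta : (0 < n)%N -> (0 < m)%N -> (17 <= d)%N ->
  0 < delta -> 1 <= delta * d%:R -> 0 < alpha -> alpha < 1 ->
  72 / delta < d%:R `^ (1 - alpha) -> 72 / delta * d%:R `^ alpha < m%:R ->
  (7 * m)%:R * ln ((8 * m * d)%:R : R) <= ln n%:R / 4 ->
  [/\ (2 * d <= n)%N, (2 * (8 * m + 2 * d ^ 2 + 2 * d) <= n * d)%N,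
    (8 * m ^ 2 * (4 * m).+1 * (8 * m * d) ^ (4 * m))%:R / (n%:R `^ (3 / 4)) ^+ 2
      <= n%:R `^ (- (5 / 4)) :> R &
    24 / m.+1%:R + 12 / (d%:R - 1) + 8 * m%:R ^+ 2 * n%:R `^ (3 / 4) / n%:R
      < delta * d%:R `^ (- alpha)].
Proof.
move=> n0 m0 d17 delta0 deltad alpha0 alpha1 H2 H3 K.
have d0 : (0 < d)%N by apply: leq_trans d17.
have nR : 0 < n%:R :> R by rewrite ltr0n.
have dR : 17 <= d%:R :> R by rewrite ler_nat.
have mR : 1 <= m%:R :> R by rewrite ler1n.
have W := walk_bound_powR m0 d0 n0 K.
have q0 : (0 < 8 * m * d)%N by rewrite !muln_gt0 m0 d0.
have q3W : ((8 * m * d) ^ 3 <= (8 * m * d) ^ (7 * m))%N.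
  by apply: leq_pexp2l => //; rewrite (@leq_trans 7) // leq_pmulr.
have q3n4 : ((8 * m * d) ^ 3)%:R <= n%:R `^ (4^-1) :> R.
  by apply: le_trans W; rewrite ler_nat.
have q3n : ((8 * m * d) ^ 3 <= n)%N.
  rewrite -(ler_nat R) (le_trans q3n4) // ler1_powR ?ler1n //; lra.
have q3E : ((8 * m * d) ^ 3 = 512 * (m * m * m) * (d * d * d))%N by ring.
have x0 : 0 < d%:R `^ (- alpha) :> R by rewrite powR_gt0; lra.
have [cb1 cb2 cb3] := cube_bounds m0 d0.
have e47 : (3 + 4 * m <= 7 * m)%N by clear -m0; lia.
have xE : d%:R `^ (- alpha) * d%:R `^ alpha = 1 :> R.
  by rewrite -powRD ?addNr ?powRr0 ?eqxx //=; rewrite pnatr_eq0 gtn_eqF.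
split.
- exact: leq_trans q3n.
- apply: (@leq_trans (n * 1)); last by rewrite leq_mul2l d0 orbT.
  by rewrite muln1; apply: leq_trans q3n.
- rewrite ler_pdivrMr ?exprn_gt0 ?powR_gt0 //.
  rewrite -powR_mulrn ?powR_ge0 // -powRrM -powRD; last by rewrite pnatr_eq0 gtn_eqF ?implybT.
  have -> : - (5 / 4) + 3 / 4 * 2 = 4^-1 :> R by field.
  apply: le_trans W; rewrite ler_nat.
  apply: (@leq_trans ((8 * m * d) ^ 3 * (8 * m * d) ^ (4 * m))).
    by rewrite leq_mul2r cb3 orbT.
  by rewrite -expnD; apply: leq_pexp2l => //; rewrite e47.
set x := d%:R `^ (- alpha) in x0 xE *; set y := d%:R `^ alpha in H3 xE.
have y0 : 0 < y by rewrite powR_gt0; lra.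
have dx : d%:R * x = d%:R `^ (1 - alpha).
  by rewrite powRD ?powRr1 //; apply/implyP => _; rewrite gt_eqF //; lra.
have t1 : 24 / m.+1%:R < delta / 3 * x.
  rewrite ltr_pdivrMr ?ltr0n //.
  have : 72 / delta * y * (delta * x) < m%:R * (delta * x) by rewrite ltr_pM2r // mulr_gt0.
  have -> : 72 / delta * y * (delta * x) = 72 * (x * y) by field; rewrite gt_eqF.
  rewrite xE mulr1 -natr1; have : 0 < delta * x by rewrite mulr_gt0.
  by lra.
have t2 : 12 / (d%:R - 1) < delta / 3 * x.
  rewrite ltr_pdivrMr; last by lra.
  have : 72 / delta * delta < d%:R * x * delta by rewrite dx ltr_pM2r.
  rewrite divfK ?gt_eqF //; have : 17 * (delta * x) <= d%:R * (delta * x).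
    by rewrite ler_wpM2r // mulr_ge0 // ltW.
  by move: (d%:R) => D; nra.
have t3 : 8 * m%:R ^+ 2 * n%:R `^ (3 / 4) / n%:R < delta / 3 * x.
  rewrite -mulrA; have -> : n%:R `^ (3 / 4) / n%:R = (n%:R `^ (4^-1))^-1 :> R.
    rewrite -powRN (_ : - 4^-1 = 3 / 4 - 1); last by field.
    by rewrite powRB ?powRr1 // pnatr_eq0 (gtn_eqF n0) implybT.
  rewrite ltr_pdivrMr ?powR_gt0 //.
  have dx1 : 1 <= d%:R * x.
    by rewrite dx -[leLHS](powRr0 d%:R); apply: ler_powR; lra.
  (* 512 m^3 d^3 <= n^(1/4); two of the three factors d pay for delta x, through delta d >= 1 and d
     x >= 1. *)
  have p1 : 512 * m%:R ^+ 3 * d%:R <= delta * x * n%:R `^ 4^-1.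
    apply: (@le_trans _ _ (delta * x * ((8 * m * d) ^ 3)%:R)); last first.
      by rewrite ler_wpM2l // mulr_ge0 // ltW.
    rewrite q3E !natrM.
    have -> : delta * x * (512 * (m%:R * m%:R * m%:R) * (d%:R * d%:R * d%:R)) =
      512 * m%:R ^+ 3 * d%:R * ((delta * d%:R) * (d%:R * x)) by ring.
    apply: ler_peMr.
      exact: mulr_ge0 (mulr_ge0 (ler0n R 512) (exprn_ge0 3 (ler0n R m))) (ler0n R d).
    by rewrite -[leLHS](mulr1 1); apply: ler_pM; rewrite ?ler01.
  have p2 : m%:R ^+ 2 <= m%:R ^+ 3 :> R by rewrite ler_weXn2l.
  have p3 : m%:R ^+ 3 * 17 <= m%:R ^+ 3 * d%:R :> R by rewrite ler_wpM2l ?exprn_ge0.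
  have p4 : 0 < m%:R ^+ 2 :> R by rewrite exprn_gt0 ?ltr0n.
  by lra.
have -> : delta * x = delta / 3 * x + delta / 3 * x + delta / 3 * x by field.
exact: ltrD (ltrD t1 t2) t3.
Qed.

Lemma near_parameters (delta gamma alpha : R) (d : nat -> nat) :
  0 < delta -> 0 < gamma -> 0 < alpha -> alpha < 1 -> alpha * gamma < 1 ->
  (\forall n \near \oo, `|(d n)%:R - ln (n%:R : R) `^ gamma| <= 1) ->
  \forall n \near \oo, exists m : nat,
    [/\ (0 < m)%N, (17 <= d n)%N, 1 <= delta * (d n)%:R,
      72 / delta < (d n)%:R `^ (1 - alpha) & 72 / delta * (d n)%:R `^ alpha < m%:R] /\
    (7 * m)%:R * ln ((8 * m * d n)%:R : R) <= ln n%:R / 4.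
Proof.
move=> delta0 gamma0 alpha0 alpha1 ag d_log.
(* Midpoint of alpha gamma and 1: m of order (log n)^beta dominates d^alpha, while m log(md) stays
   o(log n). *)
pose beta := (1 + alpha * gamma) / 2.
have ag0 : 0 < alpha * gamma by rewrite mulr_gt0.
have beta0 : 0 < beta by rewrite /beta; lra.
have beta1 : beta < 1 by rewrite /beta; lra.
have agb : 0 < beta - gamma * alpha by rewrite /beta; nra.
(* Chosen so that (beta + gamma) e = (1 - beta)/2; then ln(8md) <= (8md)^e / e is of order L^((1 -
   beta)/2), with L = ln n. *)
pose e := (1 - beta) / 2 / (beta + gamma).
have bg0 : 0 < beta + gamma by lra.
have e0 : 0 < e by rewrite divr_gt0 //; lra.
have e1 : 0 < (1 - beta) / 2 by lra.
(* Lower bound for d: its three entries serve d >= 17, delta d >= 1 and d^(1 - alpha) > 72/delta. *)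
pose T := Num.max (Num.max 17 delta^-1) ((72 / delta + 1) `^ (1 - alpha)^-1).
have T17 : 17 <= T by rewrite /T !le_max lexx.
have Td : delta^-1 <= T by rewrite /T !le_max lexx orbT.
have Ta : (72 / delta + 1) `^ (1 - alpha)^-1 <= T by rewrite /T !le_max lexx orbT.
near=> n.
have h1 : `|(d n)%:R - ln (n%:R : R) `^ gamma| <= 1 by near: n.
have h2 : 2 * T <= ln (n%:R : R) `^ gamma by near: n; exact: near_powR_ln.
have h3 : 72 / delta * 2 `^ alpha + 1 <= ln (n%:R : R) `^ (beta - gamma * alpha).
  by near: n; exact: near_powR_ln.
(* From m <= 2 L^beta and d <= 2 L^gamma: 8md <= 32 L^(beta + gamma) and 7m <= 14 L^beta, and 56 = 4
   times 14. *)
have h4 : 56 * (32 `^ e / e) <= ln (n%:R : R) `^ ((1 - beta) / 2) by near: n; exact: near_powR_ln.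
have L1 : 1 <= ln (n%:R : R).
  have n0 : 1 <= n%:R :> R by near: n; exact: nbhs_infty_ger.
  have : 1 <= ln (n%:R : R) `^ 1 by near: n; exact: near_powR_ln.
  by rewrite powRr1 // ln_ge0.
set L := ln (n%:R : R) in h1 h2 h3 h4 L1 *.
have L0 : 0 < L by lra.
have pow_gt0 c : 0 < L `^ c by rewrite powR_gt0.
have pow_ge1 c : 0 <= c -> 1 <= L `^ c.
  by move=> c0; rewrite -[leLHS](powRr0 L) ler_powR.
have powD a b : L `^ (a + b) = L `^ a * L `^ b.
  by rewrite powRD // (gt_eqF L0) implybT.
have D1 : T <= (d n)%:R by move: h1; rewrite ler_norml => /andP[? ?]; lra.
have D2 : (d n)%:R <= 2 * L `^ gamma by move: h1; rewrite ler_norml => /andP[? ?]; lra.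
have D0 : 0 < (d n)%:R :> R by lra.
pose m := (Num.truncn (L `^ beta)).+1; exists m.
have m1 : L `^ beta < m%:R by exact: truncnS_gt.
have m2 : m%:R <= 2 * L `^ beta.
  have /andP[] := truncn_itv (powR_ge0 L beta); rewrite -natr1.
  by have := pow_ge1 beta (ltW beta0); lra.
split; first split => //.
- by rewrite -(ler_nat R); lra.
- by rewrite -ler_pdivrMl // mulr1; lra.
- apply: (@lt_le_trans _ _ (72 / delta + 1)); first by lra.
  have c0 : 0 <= 72 / delta + 1 by rewrite addr_ge0 // divr_ge0 // ltW.
  have a1 : 0 < 1 - alpha by lra.
  have {1}-> : 72 / delta + 1 = ((72 / delta + 1) `^ (1 - alpha)^-1) `^ (1 - alpha).
    by rewrite -powRrM mulVf ?powRr1 // gt_eqF.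
  by apply: ge0_ler_powR; rewrite ?nnegrE ?powR_ge0 ?(ltW a1) ?(ltW D0) // (le_trans Ta).
- apply: le_lt_trans m1.
  have : (d n)%:R `^ alpha <= 2 `^ alpha * L `^ (gamma * alpha).
    rewrite (powRrM L) -powRM ?powR_ge0 //.
    by apply: ge0_ler_powR; rewrite ?nnegrE ?mulr_ge0 ?powR_ge0 // ltW.
  have c0 : 0 <= 72 / delta by rewrite divr_ge0 // ltW.
  move=> /(ler_wpM2l c0)/le_trans; apply.
  rewrite -(subrK (gamma * alpha) beta) powD mulrA ler_wpM2r ?powR_ge0 //; lra.
have q0 : 0 < (8 * m * d n)%:R :> R by rewrite !natrM !mulr_gt0.
apply: (@le_trans _ _ ((14 * L `^ beta) * (32 `^ e / e * L `^ ((1 - beta) / 2)))).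
  apply: (@le_trans _ _ ((7 * m)%:R * ((8 * m * d n)%:R `^ e / e))).
    by rewrite ler_wpM2l // ln_le_powR.
  apply: ler_pM => //; first by rewrite divr_ge0 ?powR_ge0 // ltW.
    by rewrite natrM; lra.
  rewrite mulrAC ler_wpM2r ?invr_ge0 ?(ltW e0) //.
  have -> : (1 - beta) / 2 = (beta + gamma) * e by rewrite /e [RHS]mulrC divfK // gt_eqF.
  rewrite (powRrM L) -powRM ?powR_ge0 //.
  apply: ge0_ler_powR; rewrite ?nnegrE ?(ltW e0) ?mulr_ge0 ?powR_ge0 //.
  rewrite powD !natrM -mulrA.
  have : m%:R * (d n)%:R <= (2 * L `^ beta) * (2 * L `^ gamma) by apply: ler_pM.
  by move: (m%:R * _) (L `^ beta) (L `^ gamma) => X Y Z; lra.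
have LE : L = L `^ beta * (L `^ ((1 - beta) / 2) * L `^ ((1 - beta) / 2)).
  rewrite -!powD (_ : beta + _ = 1) ?powRr1 ?(ltW L0) //; by field.
have := ler_wpM2l (mulr_ge0 (ltW (pow_gt0 beta)) (ltW (pow_gt0 ((1 - beta) / 2)))) h4.
rewrite [L / 4](congr1 (fun z => z / 4) LE).
move: (L `^ beta) (L `^ ((1 - beta) / 2)) (32 `^ e / e) => X Y Z.
by clear; lra.
Unshelve. all: by end_near. Qed.


End ParameterChoice.

(** * Assembly: interval lengths and the final estimate *)

(** With x = d^(-alpha), 2 eta = e^x - e^(-x), where e^x >= 1 + x and e^(-x) <= 1. *)
Lemma two_eta_ge (R : realType) (alpha : R) (d : nat) :
  (d%:R `^ (- alpha) <= 2 * eta_ alpha d :> R)%R.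
Proof.
rewrite /eta_ /r_ -expRN; set x : R := (_ `^ _)%R.
have x0 : 0 <= x by apply: powR_ge0.
have h1 : 1 + x <= expR x := expR_ge1Dx x.
have e0 : 0 < expR x := expR_gt0 x.
rewrite mulrC divfK // expRN.
have h2 : (expR x)^-1 <= 1 by rewrite invf_le1 //; lra.
lra.
Qed.

Lemma Rintegral_f_sc (R : realType) (ba bb : bool) (a b : R) : a <= b ->
  (\int[lebesgue_measure]_(x in [set` Interval (BSide ba a) (BSide bb b)]) f_sc x =
   sc_tail (sc_angle a) - sc_tail (sc_angle b))%R.
Proof.
move=> ab; rewrite /Rintegral integral_itv_bndoo; last exact: measurable_f_sc.
rewrite -(@integral_itv_bndoo R a b _ true false); last exact: measurable_f_sc.
by rewrite integral_f_sc.
Qed.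

(** The positive lower bound on the length rules out empty and one-point intervals. *)
Lemma interval_measure_cases (R : realType) (I : interval R) (x : R) : 0 < x ->
  (x%:E <= lebesgue_measure [set` I])%E ->
  lebesgue_measure [set` I] = +oo%E \/
  exists ba bb a b, [/\ I = Interval (BSide ba a) (BSide bb b), a < b,
    x <= b - a & lebesgue_measure [set` I] = (b - a)%:E].
Proof.
move=> x0; rewrite lebesgue_measure_itv; case: I => [[ba a|[]] [bb b|[]]] /=;
  try (by rewrite ?ltry ?ltNyr; left);
  try by rewrite ?ltxx ?lte_fin ?ltNge ?leNye ?leey /= lee_fin leNgt x0.
rewrite lte_fin; case: ltP => ab; last by rewrite lee_fin leNgt x0.
by rewrite -EFinB lee_fin => xab; right; exists ba, bb, a, b.
Qed.

Lemma o_powR_inv (R : realType) :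
  (fun n : nat => n%:R `^ (- (5 / 4)) : R) =o_\oo (fun n => 1 / n%:R : R).
Proof.
apply/eqoP => e e0; near=> n.
have n1 : 1 <= n%:R :> R by near: n; exact: nbhs_infty_ger.
have ne : (e^-1) `^ 4 <= n%:R by near: n; exact: nbhs_infty_ger.
have n0 : 0 < n%:R :> R by lra.
have v0 : 0 < n%:R `^ 4^-1 :> R by rewrite powR_gt0.
have -> : n%:R `^ (- (5 / 4)) = (n%:R `^ 4^-1)^-1 * n%:R^-1 :> R.
  rewrite powRN -invfM (_ : 5 / 4 = 4^-1 + 1); last by field.
  by rewrite powRD ?powRr1 ?(ltW n0) // (gt_eqF n0) implybT.
have i0 : 0 <= n%:R^-1 :> R by rewrite invr_ge0 ltW.
rewrite div1r normrM (ger0_norm i0) ler_wpM2r // ger0_norm ?invr_ge0 ?(ltW v0) //.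
rewrite -[leRHS]invrK lef_pV2 ?posrE ?invr_gt0 //.
have ei : 0 <= e^-1 by rewrite invr_ge0 ltW.
have -> : e^-1 = ((e^-1) `^ 4) `^ 4^-1 by rewrite -powRrM divff ?powRr1.
by apply: ge0_ler_powR; rewrite ?nnegrE ?powR_ge0 // ltW.
Unshelve. all: by end_near. Qed.


Theorem theorem2 (R : realType) (delta gamma alpha : R) (d : nat -> nat)
  (delta_gt0 : 0 < delta) (delta_neq1 : delta != 1)
  (gamma_gt0 : 0 < gamma)
  (alpha_gt0 : 0 < alpha) (alpha_lt : alpha < Num.min 1 (1 / gamma))
  (d_log : \forall n \near \oo, `|(d n)%:R - ln (n%:R : R) `^ gamma| <= 1)
  (d_lt : \forall n \near \oo, (d n < n)%N)
  (d_even : \forall n \near \oo, ~~ odd (n * d n)) :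
  exists (N : nat) (p : nat -> R),
    p =o_\oo (fun n => 1 / n%:R : R) /\
    forall (n : nat) (I : interval R),
      (N <= n)%N ->
      ((Num.max (2 * eta_ alpha (d n))
                (eta_ alpha (d n) / (- delta * ln delta)))%:E
        <= lebesgue_measure [set` I])%E ->
      1 - p n <=
      Prob_G R (d n) (fun G : {set {set 'I_n}} =>
        (`|(N_ (d n) G I)%:R
           - n%:R * \int[lebesgue_measure]_(x in [set` I]) f_sc x|%:E
          < (delta * n%:R)%:E * lebesgue_measure [set` I])%E).
Proof.
have [alpha1 ag] : alpha < 1 /\ alpha * gamma < 1.
  by move: alpha_lt; rewrite lt_min ltr_pdivlMr // => /andP[].
have [N _ hN] : \forall n \near \oo, [/\ (0 < n)%N, (d n < n)%N, ~~ odd (n * d n) &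
    exists m : nat,
    [/\ (0 < m)%N, (17 <= d n)%N, 1 <= delta * (d n)%:R,
      72 / delta < (d n)%:R `^ (1 - alpha) & 72 / delta * (d n)%:R `^ alpha < m%:R] /\
    (7 * m)%:R * ln ((8 * m * d n)%:R : R) <= ln n%:R / 4].
  have np := near_parameters delta_gt0 gamma_gt0 alpha_gt0 alpha1 ag d_log.
  near=> n; split; [near: n; exact: nbhs_infty_gt | by near: n | by near: n | by near: n].
exists N, (fun n => n%:R `^ (- (5 / 4))); split; first exact: o_powR_inv.
move=> n I /hN[n0 dn odd_nd [m [[m0 d17 dd H2 H3] K]]] hI.
have d0 : (0 < d n)%N by apply: leq_trans d17.
have [c1 c2 c3 c4] := parameters_ok n0 m0 d17 delta_gt0 dd alpha_gt0 alpha1 H2 H3 K.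
have nR : 0 < n%:R :> R by rewrite ltr0n.
have x0 : 0 < (d n)%:R `^ (- alpha) :> R by rewrite powR_gt0 // ltr0n.
have hx : (((d n)%:R `^ (- alpha))%:E <= lebesgue_measure [set` I])%E.
  apply: le_trans hI; rewrite lee_fin le_max; apply/orP; left; exact: two_eta_ge.
apply: (@le_trans _ _ (1 - (8 * m ^ 2 * (4 * m).+1 * (8 * m * d n) ^ (4 * m))%:R
  / (n%:R `^ (3 / 4)) ^+ 2)); first by rewrite lerB.
(* The threshold is tau = n^(3/4); below it the rest of the argument is deterministic. *)
apply: Prob_G_ge => //; first by rewrite powR_gt0.
  exact: regular_graphs_neq0.
move=> G rG short.
have [->|[ba [bb [a [b [-> ab xab ->]]]]]] := interval_measure_cases x0 hx.
  (* On an interval of infinite length the right-hand side is +oo. *)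
  by rewrite gt0_muley ?ltry // lte_fin mulr_gt0.
rewrite Rintegral_f_sc ?ltW // -EFinM lte_fin.
apply: (le_lt_trans (N_interval_bound rG m0 d17 ba bb ab)).
apply: (@le_lt_trans _ _ (n%:R * (24 / m.+1%:R + 12 / ((d n)%:R - 1) +
   8 * m%:R ^+ 2 * n%:R `^ (3 / 4) / n%:R))).
  rewrite [leRHS]mulrDr lerD2l [leRHS]mulrC divfK ?gt_eqF // natrM natrM natrX.
  by rewrite ler_wpM2l // mulr_ge0 // exprn_ge0.
rewrite [ltRHS](_ : _ = n%:R * (delta * (b - a))); last by ring.
rewrite ltr_pM2l // (lt_le_trans c4) //.
by rewrite ler_wpM2l // ltW.
Unshelve. all: by end_near. Qed.
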